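(* Let $F$, $\Lambda$, $E^c$, $P=(0,1,0)$ and $Q=(0,0,0)$ be as described in the context (for any admissible choice of parameters). Then: 1. For any recurrent point $p\in\Lambda$ different from $Q$, $$\liminf_{n\to+\infty}\frac1n\log\big|DF^n(p)|_{E^c}\big|\le 0.$$ Moreover, any ergodic $F$-invariant probability measure different from $\delta_Q$ has negative central Lyapunov exponent. 2. If $(\mu_n)$ is a sequence of ergodic $F$-invariant probability measures such that $\lambda^c_{\mu_n}$ converges to zero, then $\mu_n$ converges to $\frac{\delta_Q+\delta_P}{2}$ in the weak$^\star$ topology.
   Context: Let $I=[0,1]$, $R=I^3\subset\mathbb{R}^3$, $R_0=I\times I\times[0,1/6]$, $R_1=I\times I\times[5/6,1]$. Fix parameters $0<\lambda_0<1/3$, $\beta_0>6$, $0<\lambda_1<1/3$, $0<\sigma<1/3$, $3<\beta_1<4$. Let $f:I\to I$ be the time-one map of the vector field $x'=x(1-x)$, i.e. $f(y)=\dfrac{y}{y+(1-y)e^{-1}}$; thus $f(0)=0$, $f(1)=1$, $f'(0)=e$, $f'(1)=1/e$. The map $F$ is defined on $R_0\cup R_1$ by $F(x,y,z)=(\lambda_0x,\,f(y),\,\beta_0z)$ if $(x,y,z)\in R_0$, and $F(x,y,z)=(\tfrac34-\lambda_1x,\ \sigma(1-y),\ \beta_1(z-\tfrac56))$ if $(x,y,z)\in R_1$. $F$ is injective on $R_0\cup R_1$. $\Lambda$ is the maximal invariant set of $F$ in the cube: the compact set of points having a full (forward and backward) $F$-orbit contained in $R_0\cup R_1$. $F$ restricts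 to a homeomorphism of $\Lambda$. The points $Q=(0,0,0)$ and $P=(0,1,0)$ are fixed by $F$. $E^c$ is the direction of the $y$-axis, so $|DF(x,y,z)|_{E^c}|$ equals $f'(y)$ if $z\le1/6$ and $\sigma$ if $z\ge5/6$, and $|DF^n(p)|_{E^c}|=\prod_{j=0}^{n-1}|DF(F^j(p))|_{E^c}|$. $F$-invariant measures are Borel probability measures on $\Lambda$ invariant under $F$. The central Lyapunov exponent of an invariant measure $\mu$ is $\lambda^c_\mu=\int\log|DF|_{E^c}|\,d\mu$. A point $p\in\Lambda$ is recurrent if $F^{n_k}(p)\to p$ for some sequence $n_k\to+\infty$. $\delta_X$ is the Dirac measure at $X$. *)

(* Defs.v *)
From HB Require Import structures.
From mathcomp Require Import all_boot all_order all_algebra.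
From mathcomp Require Import all_classical all_reals all_analysis.

Set Implicit Arguments.
Unset Strict Implicit.
Unset Printing Implicit Defensive.

Import Order.TTheory GRing.Theory Num.Theory.
Import numFieldNormedType.Exports.

Local Open Scope classical_set_scope.
Local Open Scope ring_scope.

(* The point (x, y, z) is the nested pair ((x, y), z).  The topology and the
   sigma-algebra on R * R * R are the product ones; the latter is therefore the
   Borel sigma-algebra of R^3. *)

Record params (R : realType) := Params {
  lam0 : R; beta0 : R; lam1 : R; sigma : R; beta1 : R;
  lam0_bounds : 0 < lam0 < 1 / 3;
  beta0_bounds : 6 < beta0;
  lam1_bounds : 0 < lam1 < 1 / 3;
  sigma_bounds : 0 < sigma < 1 / 3;
  beta1_bounds : 3 < beta1 < 4 }.

Section Horseshoe.
Variables (R : realType) (c : params R).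
Local Notation R3 := (R * R * R)%type.
Implicit Types (p : R3) (n : nat).

Definition slab0 : set R3 := `[0, 1] `*` `[0, 1] `*` `[0, 1 / 6].
Definition slab1 : set R3 := `[0, 1] `*` `[0, 1] `*` `[5 / 6, 1].

Definition fiber_map (y : R) : R := y / (y + (1 - y) * expR (- 1)).

(* Only the values on slab0 and slab1 matter; the two formulas are extended to
   z <= 1/6 and z > 1/6 so that F is total, and near every point of
   slab0 `|` slab1 the map is given on the line parallel to Ec by the formula
   of the slab containing the point. *)
Definition F p : R3 :=
  let: (x, y, z) := p in
  if z <= 1 / 6
  then (lam0 c * x, fiber_map y, beta0 c * z)
  else (3 / 4 - lam1 c * x, sigma c * (1 - y), beta1 c * (z - 5 / 6)).

Definition Lambda : set R3 :=
  [set p | exists o : int -> R3,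
     [/\ o 0 = p, forall k, (slab0 `|` slab1) (o k)
       & forall k, o (k + 1) = F (o k)]].

Definition Q : R3 := (0, 0, 0).
Definition P : R3 := (0, 1, 0).

(* |DF^n(p)| restricted to E^c: norm of the derivative of F^n at p along the
   unit vector Ec of the y-axis.  The third coordinate of F does not depend on
   y, so along this line every iterate stays in the branch of F used by the
   orbit of p, including when that orbit meets the faces of the slabs. *)
Definition Ec : R3 := (0, 1, 0).
Definition DFc n p : R := `|'D_Ec (iter n F) p|.

Definition recurrent p :=
  exists2 u : nat -> nat, u @ \oo --> \oo & iter (u k) F p @[k --> \oo] --> p.

(* An F-invariant Borel probability on Lambda, encoded as a Borel probability
   on R^3 carried by Lambda; the preimage is taken under F restricted to
   Lambda. *)
Definition invariant_measure (mu : probability R3 R) :=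
  mu Lambda = 1%E /\
  forall A, measurable A -> mu (Lambda `&` F @^-1` A) = mu A.

Definition ergodic_measure (mu : probability R3 R) :=
  invariant_measure mu /\
  forall A, measurable A -> A `<=` Lambda -> Lambda `&` F @^-1` A = A ->
    mu A = 0%E \/ mu A = 1%E.

Definition lyap (mu : probability R3 R) : R :=
  \int[mu]_(p in Lambda) ln (DFc 1 p).

Definition half_QP : {measure set R3 -> \bar R} :=
  mscale (2^-1)%:nng (measure_add \d_Q \d_P).

(* Weak-star convergence of measures on the compact space Lambda: the test
   functions are those continuous for the subspace topology of Lambda. *)
Definition weak_star_cvg (mu_ : nat -> probability R3 R)
    (nu : {measure set R3 -> \bar R}) :=
  forall g : R3 -> R, {within Lambda, continuous g} ->
    \int[mu_ n]_(p in Lambda) g p @[n --> \oo] --> \int[nu]_(p in Lambda) g p.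
End Horseshoe.

Arguments Q {R}.
Arguments P {R}.
Arguments half_QP {R}.

(* Main.v *)
(** Along the centre direction the first branch is the time-one map of the
    logistic field X y = y (1 - y), so f' = (X o f) / X, while
    sigma X y <= X (sigma (1 - y)).  Hence |DF^n|_Ec| <= (X o F^n) / X is bounded
    along every orbit that enters 0 < y < 1; the orbits that never do so either
    stay on y = 1 or end on the stable manifold of Q, which contains no
    recurrent point but Q.

    For an invariant measure, ln X is a transfer function: ln |DF|_Ec| is
    ln X o F - ln X minus a nonnegative term supported on the slab z >= 5/6 and
    comparable there to 1 - y.  Shifting y and 1 - y by a small d makes the
    transfer function bounded, at the price of an error d / (y + d) that vanishes
    in mean as soon as mu (y = 0) = 0, which for an ergodic measure holds unless
    mu {Q} = 1.  A second transfer function, ln (y / (1 - y)) shifted by d, gains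
    at most 1 on z <= 1/6 and loses about ln (1 / d) at a point of z >= 5/6 with
    y near 1, so mu (z >= 5/6) is controlled by the exponent.  Finally x, y, z
    used as transfer functions bound the means of x, z and y (1 - y) by
    mu (z >= 5/6): a small exponent forces mu close to {Q, P}, and since
    ln |DF|_Ec| is 1 at Q and -1 at P the two masses tend to 1/2. *)

Require Import Defs.
From HB Require Import structures.
From mathcomp Require Import all_boot all_order all_algebra.
From mathcomp Require Import all_classical all_reals all_analysis.
From mathcomp Require Import ring lra measurable_realfun.

Import Order.TTheory GRing.Theory Num.Theory.
Import numFieldNormedType.Exports.

Local Open Scope classical_set_scope.
Local Open Scope ring_scope.

Set Implicit Arguments.
Unset Strict Implicit.
Unset Printing Implicit Defensive.

(** * The logistic time-one map *)

Section RealFacts.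
Context {R : realType}.
Implicit Types y s dl : R.

Lemma expRN1_bounds : 0 < expR (-1 : R) <= 2^-1.
Proof.
rewrite expR_gt0 /= expRN lef_pV2 ?posrE ?expR_gt0 //.
by have := @expR_ge1Dx R 1; rewrite (_ : 1 + 1 = 2).
Qed.

(** Denominator of [fiber_map]. The derivative of [fiber_map] is [expR (-1) / fiber_denom y ^+ 2],
    so estimates on its logarithm reduce to [ln (fiber_denom y)]. *)
Definition fiber_denom y : R := y + (1 - y) * expR (-1).

Lemma fiber_denom_bounds y : 0 <= y <= 1 ->
  [/\ expR (-1) <= fiber_denom y, fiber_denom y <= 1 & 0 < fiber_denom y].
Proof.
have := expRN1_bounds; rewrite /fiber_denom; set e := expR (-1) => /andP[e0 e2] /andP[y0 y1].
by split; nra.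
Qed.

Lemma fiber_mapE y : fiber_map y = y / fiber_denom y.
Proof. by []. Qed.

Lemma fiber_map_onem y : 0 <= y <= 1 ->
  1 - fiber_map y = (1 - y) * expR (-1) / fiber_denom y.
Proof.
move=> /fiber_denom_bounds[_ _ D0]; rewrite fiber_mapE.
have Dn0 : fiber_denom y != 0 by rewrite gt_eqF.
rewrite -[X in X - _](divff Dn0) -mulrBl; congr (_ / _).
by rewrite /fiber_denom; ring.
Qed.

Lemma ln_le_sub1 s : 0 < s -> ln s <= s - 1.
Proof.
move=> s0; have := @le_ln1Dx R (s - 1); rewrite subrKC; apply.
by lra.
Qed.

Lemma ln_ge_subV s : 0 < s -> 1 - s^-1 <= ln s.
Proof.
move=> s0; have := @ln_le_sub1 s^-1; rewrite invr_gt0 => /(_ s0).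
by rewrite lnV ?posrE //; lra.
Qed.

Lemma fiber_denom_gt0 y : 0 <= y <= 1 -> 0 < fiber_denom y.
Proof. by case/fiber_denom_bounds. Qed.

Lemma ln_mul_pos (a b : R) : 0 < a -> 0 < b -> ln (a * b) = ln a + ln b.
Proof. by move=> a0 b0; rewrite lnM ?posrE. Qed.

Lemma ln_div_pos (a b : R) : 0 < a -> 0 < b -> ln (a / b) = ln a - ln b.
Proof. by move=> a0 b0; rewrite ln_div ?posrE. Qed.

Lemma ler_ln_pos (a b : R) : 0 < a -> a <= b -> ln a <= ln b.
Proof. by move=> a0 ab; rewrite ler_ln ?posrE // (lt_le_trans a0). Qed.

Lemma ln_fiber_deriv y : 0 <= y <= 1 ->
  ln (expR (-1) / fiber_denom y ^+ 2) = -1 - 2 * ln (fiber_denom y).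
Proof.
move=> /fiber_denom_gt0 D0.
by rewrite ln_div_pos ?exprn_gt0 ?expR_gt0 // expRK lnXn // mulr_natl.
Qed.

Lemma ln_fiber_shift y dl : 0 <= y <= 1 -> 0 < dl ->
  ln (fiber_map y + dl) = ln (y + dl * fiber_denom y) - ln (fiber_denom y).
Proof.
move=> y01 dl0; have D0 := fiber_denom_gt0 y01; case/andP: y01 => y0 y1.
rewrite -ln_div_pos // ?ltr_wpDl ?mulr_gt0 //; congr (ln _).
by rewrite fiber_mapE [RHS]mulrDl mulfK // gt_eqF.
Qed.

Lemma ln_fiber_shift_onem y dl : 0 <= y <= 1 -> 0 < dl ->
  ln (1 - fiber_map y + dl) =
  ln ((1 - y) * expR (-1) + dl * fiber_denom y) - ln (fiber_denom y).
Proof.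
move=> y01 dl0; have D0 := fiber_denom_gt0 y01.
rewrite fiber_map_onem //; case/andP: y01 => y0 y1.
rewrite -ln_div_pos // ?ltr_wpDl ?mulr_ge0 ?mulr_gt0 ?subr_ge0 ?expR_ge0 //.
by congr (ln _); rewrite [RHS]mulrDl mulfK // gt_eqF.
Qed.

Lemma ln_fiber_shift_onem_ge y dl : 0 <= y <= 1 -> 0 < dl ->
  ln (1 - y + dl) - 1 <= ln ((1 - y) * expR (-1) + dl * fiber_denom y).
Proof.
move=> y01 dl0; have [D0 _ _] := fiber_denom_bounds y01.
case/andP: y01 => y0 y1; have e0 := expR_gt0 (-1 : R).
have -> : ln (1 - y + dl) - 1 = ln ((1 - y + dl) * expR (-1)).
  by rewrite ln_mul_pos ?expR_gt0 ?expRK //; lra.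
by apply: ler_ln_pos; nra.
Qed.

(** Bounded versions of ln (y (1 - y)) and, in [log_diff], of ln (y / (1 - y)). The latter, at [dl]
    = 0, is the time coordinate of the logistic flow, which [fiber_map] advances by exactly 1. *)
Definition log_sum dl y : R := ln (y + dl) + ln (1 - y + dl).
Definition log_diff dl y : R := ln (y + dl) - ln (1 - y + dl).

(** At [dl] = 0 this is the equality ln f' = ln X o f - ln X. Shifting 1 - y only helps
    ([ln_fiber_shift_onem_ge]). Shifting y leaves [y + dl * fiber_denom y] in place of [y + dl], and
    the last term pays for that loss. *)
Lemma log_sum_fiber y dl : 0 <= y <= 1 -> 0 < dl ->
  ln (expR (-1) / fiber_denom y ^+ 2) <=
  log_sum dl (fiber_map y) - log_sum dl y + (expR (-1))^-1 * (dl / (y + dl)).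
Proof.
move=> y01 dl0; have [D1 D2 D0] := fiber_denom_bounds y01.
have e0 := expR_gt0 (-1 : R).
rewrite /log_sum ln_fiber_deriv // ln_fiber_shift // ln_fiber_shift_onem //.
have := ln_fiber_shift_onem_ge y01 dl0.
have y0 : 0 <= y by case/andP: y01.
have yd0 : 0 < y + dl * fiber_denom y by rewrite ltr_wpDl ?mulr_gt0.
have yd : 0 < y + dl by rewrite ltr_wpDl.
have := ln_ge_subV (divr_gt0 yd0 yd); rewrite ln_div_pos // invf_div.
suff : (y + dl) / (y + dl * fiber_denom y) - 1 <= (expR (-1))^-1 * (dl / (y + dl)) by lra.
rewrite -[X in _ - X](divff (lt0r_neq0 yd0)) -mulrBl ler_pdivrMr //.
rewrite [leRHS](_ : _ = dl * ((y + dl * fiber_denom y) / (expR (-1) * (y + dl)))); last first.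
  by field; rewrite !gt_eqF.
rewrite (_ : y + dl - _ = dl * (1 - fiber_denom y)); last by ring.
rewrite ler_pM2l // ler_pdivlMr ?mulr_gt0 //.
have e1 : expR (-1) <= 1 :> R by lra.
have A1 : expR (-1) * y <= y by rewrite ler_piMl.
have A2 : expR (-1) * dl <= dl * fiber_denom y by rewrite mulrC ler_pM2l.
apply: (@le_trans _ _ (expR (-1) * (y + dl))); last by lra.
by rewrite ler_piMl ?mulr_ge0 ?(ltW e0) ?(ltW yd) //; lra.
Qed.

(** The summands are paired crosswise. The new y + dl is at least s times the old 1 - y + dl, which
    gives ln s. The new 1 - y + dl exceeds the old y + dl by (1 - y) (1 - s); since 1 - s > 2/3 and
    the quotient has denominator at most 2, the gain is at least (1 - y) / 3. *)
Lemma log_sum_contr (s : R) y dl : 0 <= y <= 1 -> 0 < dl <= 1 -> 0 < s < 1 / 3 ->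
  ln s + 1 / 3 * (1 - y) <= log_sum dl (s * (1 - y)) - log_sum dl y.
Proof.
move=> /andP[y0 y1] /andP[d0 d1] /andP[s0 s1]; rewrite /log_sum.
have H1 : ln s + ln (1 - y + dl) <= ln (s * (1 - y) + dl).
  by rewrite -ln_mul_pos //; [apply: ler_ln_pos; [apply: mulr_gt0 => //; lra|nra]|lra].
have p1 : 0 < 1 - s * (1 - y) + dl by nra.
have p2 : 0 < y + dl by lra.
have := ln_ge_subV (divr_gt0 p1 p2); rewrite ln_div_pos // invf_div.
suff : 1 / 3 * (1 - y) <= 1 - (y + dl) / (1 - s * (1 - y) + dl) by lra.
rewrite -[X in _ <= X - _](divff (lt0r_neq0 p1)) -mulrBl ler_pdivlMr //.
rewrite (_ : 1 - _ + dl - (y + dl) = (1 - y) * (1 - s)); last by ring.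
have : 0 <= s * (1 - y) by apply: mulr_ge0; lra.
move=> ?; rewrite [leLHS](_ : _ = (1 - y) * (1 / 3 * (1 - s * (1 - y) + dl))); last by ring.
by apply: ler_wpM2l; lra.
Qed.

Lemma log_diff_fiber y dl : 0 <= y <= 1 -> 0 < dl ->
  log_diff dl (fiber_map y) - log_diff dl y <= 1.
Proof.
move=> y01 dl0; have [D1 D2 D0] := fiber_denom_bounds y01.
rewrite /log_diff ln_fiber_shift // ln_fiber_shift_onem //.
have := ln_fiber_shift_onem_ge y01 dl0.
suff : ln (y + dl * fiber_denom y) <= ln (y + dl) by lra.
case/andP: y01 => y0 y1.
by apply: ler_ln_pos; [rewrite ltr_wpDl ?mulr_gt0|rewrite lerD2l ger_pMr].
Qed.

Lemma log_diff_contr (s : R) y dl : 0 <= y <= 1 -> 0 < dl -> 0 < s < 1 / 3 ->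
  log_diff dl (s * (1 - y)) <= 0.
Proof.
move=> /andP[y0 y1] d0 /andP[s0 s1]; rewrite /log_diff subr_le0.
have ? : s * (1 - y) <= 1 / 3 by nra.
have ? : 0 <= s * (1 - y) by apply: mulr_ge0; lra.
by apply: ler_ln_pos; lra.
Qed.

(** The first term is the value at y = 1. Between y and 1 both logarithms have their argument moved
    by 1 - y, and ln is 1 / dl - Lipschitz above dl. *)
Lemma log_diff_ge y dl : 0 <= y <= 1 -> 0 < dl ->
  ln ((1 + dl) / dl) - 2 / dl * (1 - y) <= log_diff dl y.
Proof.
move=> /andP[y0 y1] d0; rewrite /log_diff ln_div_pos //; last by lra.
have d1 : 0 <= dl^-1 by rewrite invr_ge0 ltW.
have p1 : 0 < y + dl by lra.
have p2 : 0 < 1 + dl by lra.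
have p3 : 0 < 1 - y + dl by lra.
have H : forall a b : R, dl <= b -> 0 < a -> 0 <= a - b ->
    ln a - ln b <= (a - b) / dl.
  move=> a b db a0 ab; have b0 := lt_le_trans d0 db.
  rewrite -ln_div_pos //; apply: (le_trans (ln_le_sub1 (divr_gt0 a0 b0))).
  rewrite -[X in _ - X](divff (lt0r_neq0 b0)) -mulrBl ler_wpM2l //.
  by rewrite lef_pV2 // posrE.
have H1 := H (1 + dl) (y + dl) ltac:(lra) p2 ltac:(lra).
have H2 := H (1 - y + dl) dl (lexx _) p3 ltac:(lra).
rewrite (_ : 1 + dl - (y + dl) = 1 - y) in H1; last by ring.
rewrite (_ : 1 - y + dl - dl = 1 - y) in H2; last by ring.
by rewrite (_ : 2 / dl * (1 - y) = (1 - y) / dl + (1 - y) / dl); [lra|field; rewrite gt_eqF].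
Qed.

Lemma fiber_map_gain y : 0 <= y <= 1 -> 1 / 2 * (y * (1 - y)) <= fiber_map y - y.
Proof.
move=> y01; have [D1 D2 D0] := fiber_denom_bounds y01.
case/andP: y01 => y0 y1; have /andP[e0 e1] := expRN1_bounds.
have Dn : fiber_denom y != 0 by rewrite gt_eqF.
rewrite fiber_mapE -[X in _ <= _ - X](mulfK Dn) -mulrBl ler_pdivlMr //.
have -> : y - y * fiber_denom y = y * (1 - y) * (1 - expR (-1)).
  by rewrite /fiber_denom; ring.
rewrite mulrAC -mulrA mulrC [leLHS]mulrC -!mulrA.
have : 0 <= y * (1 - y) by apply: mulr_ge0; lra.
nra.
Qed.

(** The affine function 1 - 2 y interpolates ln f' at the fixed points, where its values are 1 and
    -1. The error is - 2 t, where t vanishes at y = 0 and at y = 1. *)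
Lemma ln_fiber_deriv_approx y : 0 <= y <= 1 ->
  `|ln (expR (-1) / fiber_denom y ^+ 2) - (1 - 2 * y)| <=
  4 * (expR (-1))^-1 * (y * (1 - y)).
Proof.
move=> y01; rewrite ln_fiber_deriv //.
have [D1 D2 D0] := fiber_denom_bounds y01.
case/andP: y01 => y0 y1; have /andP[e0 e1] := expRN1_bounds.
have e1' : 2 <= (expR (-1 : R))^-1 by rewrite -(invrK 2) lef_pV2 ?posrE ?invr_gt0.
set t := ln (fiber_denom y) + (1 - y).
have -> : -1 - 2 * ln (fiber_denom y) - (1 - 2 * y) = - (2 * t).
  by rewrite /t; ring.
rewrite normrN normrM ger0_norm //.
have t1 : t <= 1 - y.
  suff : ln (fiber_denom y) <= 0 by rewrite /t; lra.
  by apply: le_trans (ln_le_sub1 D0) _; lra.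
have t2 : - y <= t.
  suff : -1 <= ln (fiber_denom y) by rewrite /t; lra.
  by rewrite -[leLHS]expRK ler_ln_pos.
have t3 : t <= (expR (-1))^-1 * y.
  have := ln_le_sub1 (divr_gt0 D0 e0); rewrite ln_div_pos // expRK.
  rewrite /t; suff : fiber_denom y / expR (-1) <= y / expR (-1) + 1 - y by lra.
  rewrite /fiber_denom mulrDl mulfK ?gt_eqF //; lra.
have t4 : - ((expR (-1))^-1 * (1 - y)) <= t.
  have := ln_ge_subV D0; rewrite /t.
  suff : (fiber_denom y)^-1 <= (expR (-1))^-1 * (1 - y) + 1 by lra.
  rewrite -[leLHS]mul1r ler_pdivrMr //.
  rewrite [leRHS](_ : _ = fiber_denom y / expR (-1) * (1 - y) + fiber_denom y); last by ring.
  have : 1 <= fiber_denom y / expR (-1) by rewrite ler_pdivlMr // mul1r.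
  have DE : fiber_denom y = y + (1 - y) * expR (-1) by [].
  move=> ?.
  have : 1 - y <= fiber_denom y / expR (-1) * (1 - y) by rewrite ler_peMl // subr_ge0.
  have : 0 <= (1 - y) * expR (-1) by rewrite mulr_ge0 ?subr_ge0 ?(ltW e0).
  lra.
(* The distance from y to the nearer endpoint is at most 2 y (1 - y), so the linear bound at that
   endpoint suffices on each half. *)
have tn : `|t| <= 2 * ((expR (-1))^-1 * (y * (1 - y))).
  have : `|t| <= (expR (-1))^-1 * y by rewrite ler_norml t3 andbT; nra.
  have : `|t| <= (expR (-1))^-1 * (1 - y) by rewrite ler_norml t4 /=; nra.
  case: (leP y (1 / 2)) => hy A1 A2.
  - apply: le_trans A2 _; rewrite mulrCA ler_pM2l; last by lra.
    by nra.
  - apply: le_trans A1 _; rewrite mulrCA ler_pM2l; last by lra.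
    by nra.
by lra.
Qed.

(** A time-one map transports the vector field that generates it: f' X = X o f with X y = y (1 -
    y). *)
Lemma fiber_deriv_logistic y : 0 <= y <= 1 ->
  expR (-1) / fiber_denom y ^+ 2 * (y * (1 - y)) = fiber_map y * (1 - fiber_map y).
Proof.
move=> y01; have D0 := fiber_denom_gt0 y01.
by rewrite fiber_map_onem // fiber_mapE; field; rewrite gt_eqF.
Qed.

Lemma contr_deriv_logistic (s : R) y : 0 <= y <= 1 -> 0 < s < 1 / 3 ->
  s * (y * (1 - y)) <= s * (1 - y) * (1 - s * (1 - y)).
Proof.
move=> /andP[y0 y1] /andP[s0 s1]; rewrite -mulrA ler_pM2l // mulrC.
rewrite ler_wpM2l //; nra.
Qed.

End RealFacts.

(** * Central derivative along orbits *)

Section Orbits.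
Context {R : realType} (c : params R).
Local Notation R3 := (R * R * R)%type.
Local Notation F := (F c).
Local Notation Lambda := (Lambda c).
Implicit Types p : R3.

Lemma slabsP p : (@slab0 R `|` @slab1 R) p ->
  [/\ 0 <= p.1.1 <= 1, 0 <= p.1.2 <= 1 & (0 <= p.2 <= 1 / 6) || (5 / 6 <= p.2 <= 1)].
Proof.
by rewrite /slab0 /slab1; case=> -[] [] /=; rewrite !in_itv /= => -> -> ->; rewrite ?orbT.
Qed.

Lemma F_x p : (F p).1.1 =
  if p.2 <= 1 / 6 then lam0 c * p.1.1 else 3 / 4 - lam1 c * p.1.1.
Proof. by case: p => [[x y] z]; rewrite /F /=; case: ifP. Qed.

Lemma F_y p : (F p).1.2 =
  if p.2 <= 1 / 6 then fiber_map p.1.2 else sigma c * (1 - p.1.2).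
Proof. by case: p => [[x y] z]; rewrite /F /=; case: ifP. Qed.

Lemma F_z p : (F p).2 =
  if p.2 <= 1 / 6 then beta0 c * p.2 else beta1 c * (p.2 - 5 / 6).
Proof. by case: p => [[x y] z]; rewrite /F /=; case: ifP. Qed.

Lemma Lambda_slabs p : Lambda p -> (@slab0 R `|` @slab1 R) p.
Proof. by case=> u [<- + _]; apply. Qed.

Lemma Lambda_bounds p : Lambda p ->
  [/\ 0 <= p.1.1 <= 1, 0 <= p.1.2 <= 1 & (0 <= p.2 <= 1 / 6) || (5 / 6 <= p.2 <= 1)].
Proof. by move/Lambda_slabs/slabsP. Qed.

Lemma Lambda_F p : Lambda p -> Lambda (F p).
Proof.
case=> u [u0 uS uF]; exists (fun k => u (k + 1)); split => //.
by rewrite uF u0.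
Qed.

Lemma Lambda_iter p n : Lambda p -> Lambda (iter n F p).
Proof. by move=> Lp; elim: n => [|n IH] //=; apply: Lambda_F. Qed.

Lemma Lambda_fixed p : (@slab0 R `|` @slab1 R) p -> F p = p -> Lambda p.
Proof. by move=> Sp Fp; exists (fun=> p); split. Qed.

Lemma fiber_map0 : fiber_map (0 : R) = 0.
Proof. by rewrite /fiber_map mul0r. Qed.

Lemma fiber_map1 : fiber_map (1 : R) = 1.
Proof. by rewrite /fiber_map subrr mul0r addr0 divr1. Qed.

Lemma F_Q : F Q = Q.
Proof. by rewrite /F /Q divr_ge0 //= fiber_map0 !mulr0. Qed.

Lemma F_P : F P = P.
Proof. by rewrite /F /P divr_ge0 //= fiber_map1 !mulr0. Qed.

Lemma Lambda_Q : Lambda Q.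
Proof.
apply: Lambda_fixed; last exact: F_Q.
by left; rewrite /slab0 /=; split=> //=; rewrite ?in_itv /= ?lexx ?ler01 ?divr_ge0.
Qed.

Lemma Lambda_P : Lambda P.
Proof.
apply: Lambda_fixed; last exact: F_P.
by left; rewrite /slab0 /=; split=> //=; rewrite ?in_itv /= ?lexx ?ler01 ?divr_ge0.
Qed.

(** Closed form of the central derivative, branch by branch; [DFcE] identifies its products along
    orbits with [DFc] on [Lambda]. *)
Definition central_deriv p : R :=
  if p.2 <= 1 / 6 then expR (-1) / fiber_denom p.1.2 ^+ 2 else sigma c.

Lemma central_deriv_gt0 p : Lambda p -> 0 < central_deriv p.
Proof.
case/Lambda_bounds=> _ /fiber_denom_gt0 D0 _; rewrite /central_deriv.
case: ifP => _; last by case/andP: (sigma_bounds c).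
by rewrite divr_gt0 ?expR_gt0 ?exprn_gt0.
Qed.

Lemma is_derive_fiber_map (y : R) : 0 <= y <= 1 ->
  is_derive y 1 (@fiber_map R) (expR (-1) / fiber_denom y ^+ 2).
Proof.
move=> /fiber_denom_gt0 D0.
have Dn : fiber_denom y != 0 by rewrite gt_eqF.
have dD : is_derive y 1 (@fiber_denom R) (1 - expR (-1)).
  rewrite /fiber_denom; apply: is_derive_eq.
  by rewrite -![_ *: _]/(_ * _); ring.
have dV := is_deriveV Dn dD.
have -> : @fiber_map R = (id \* (fun t => (fiber_denom t)^-1)) by [].
apply: is_derive_eq.
rewrite -![_ *: _]/(_ * _) /= /fiber_denom in Dn *.
by field.
Qed.

Definition central_deriv_iter n p : R := \prod_(j < n) central_deriv (iter j F p).

Lemma central_deriv_iter_gt0 n p : Lambda p -> 0 < central_deriv_iter n p.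
Proof.
by move=> Lp; apply: prodr_gt0 => j _; exact/central_deriv_gt0/Lambda_iter.
Qed.

Lemma central_deriv_iterS n p :
  central_deriv_iter n.+1 p = central_deriv_iter n p * central_deriv (iter n F p).
Proof. by rewrite /central_deriv_iter big_ord_recr. Qed.

Lemma central_deriv_iterD m n p : central_deriv_iter (m + n) p =
  central_deriv_iter m p * central_deriv_iter n (iter m F p).
Proof.
elim: n => [|n IH]; first by rewrite addn0 /central_deriv_iter big_ord0 mulr1.
by rewrite addnS !central_deriv_iterS IH mulrA addnC iterD.
Qed.

(** F jumps across z = 1/6, but z is constant along the line through p parallel to [Ec], and so is
    the z coordinate of each iterate. Hence the branches taken are constant on the line, and the
    derivative is that of a composition of scalar maps. *)
Lemma iter_F_central_line n p : Lambda p ->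
  exists Y : R -> R, exists2 dY : R,
    is_derive (0 : R) (1 : R) Y dY /\ `|dY| = central_deriv_iter n p &
    forall h, iter n F (h *: (@Ec R) + p) =
              ((iter n F p).1.1, Y h, (iter n F p).2).
Proof.
move=> Lp; elim: n => [|n [Y [dY [YdY ndY] YE]]].
  exists (fun h => h + p.1.2); exists 1.
    by split; [apply: is_derive_eq; rewrite addr0|rewrite normr1 /central_deriv_iter big_ord0].
  case: p Lp => [[x y] z] _ h /=.
  rewrite -[LHS]/(h * 0 + x, h * 1 + y, h * 0 + z).
  by rewrite mulr1 !mulr0 !add0r.
have Lq := Lambda_iter n Lp.
have [_ y01 _] := Lambda_bounds Lq.
have Y0 : Y 0 = (iter n F p).1.2 by have := YE 0; rewrite scale0r add0r => ->.
rewrite -Y0 in y01.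
rewrite central_deriv_iterS /central_deriv -Y0.
case: (leP (iter n F p).2 (1 / 6)) => z6.
- exists (@fiber_map R \o Y); exists (expR (-1) / fiber_denom (Y 0) ^+ 2 * dY).
    split.
      have df := is_derive_fiber_map y01.
      exact: is_derive1_comp.
    by rewrite mulrC normrM ndY [X in _ * X]gtr0_norm ?divr_gt0 ?expR_gt0 ?exprn_gt0 ?fiber_denom_gt0.
  by move=> h; rewrite iterS YE F_x F_z {1}/F z6.
- have s0 : 0 < sigma c by case/andP: (sigma_bounds c).
  exists (fun h => sigma c * (1 - Y h)); exists (- (dY * sigma c)).
    split.
      apply: is_derive_eq; rewrite -![_ *: _]/(_ * _); ring.
    by rewrite normrN normrM ndY gtr0_norm.
  by move=> h; rewrite iterS YE F_x F_z {1}/F leNgt z6.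
Qed.

Lemma DFcE n p : Lambda p -> DFc c n p = central_deriv_iter n p.
Proof.
move=> Lp; have [Y [dY [YdY <-] YE]] := iter_F_central_line n Lp.
rewrite /DFc; suff -> : 'D_(@Ec R) (iter n F) p = (0, dY, 0).
  (* The norm on the product is the sup norm, so only the y coordinate contributes. *)
  by rewrite !prod_normE /= normr0 max_l // max_r.
apply: cvg_lim => //.
have Ep : iter n F p = ((iter n F p).1.1, Y 0, (iter n F p).2).
  by rewrite -YE scale0r add0r.
have -> : (fun h : R => h^-1 *: ((iter n F \o shift p) (h *: @Ec R) - iter n F p)) =
  (fun h => (0, h^-1 *: ((Y \o shift 0) (h *: 1) - Y 0), 0)).
  apply/funext => h /=; rewrite YE {3}Ep addr0 [h *: 1]mulr1.
  set a := _.1.1; set b := _.2.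
  rewrite -[LHS]/(h^-1 * (a - a), h^-1 * (Y h - Y 0), h^-1 * (b - b)).
  by rewrite !subrr !mulr0.
apply: (@cvg_pair _ _ _ _ (nbhs ((0 : R), dY)) (nbhs (0 : R))); last exact: cvg_cst.
apply: (@cvg_pair _ _ _ _ (nbhs (0 : R)) (nbhs dY)); first exact: cvg_cst.
case: YdY => dY0 <-; exact: dY0.
Qed.

End Orbits.

(** * Upper bounds on the derivative and the lower limit along recurrent orbits *)

Lemma limn_einf_div_le0 (R : realType) (a : nat -> R) (K : R) (N : nat) :
  (forall n, (N <= n)%N -> a n <= K) ->
  (limn_einf (fun n => (n%:R^-1 * a n)%:E) <= 0)%E.
Proof.
move=> aK; apply: (le_trans (limn_einf_sup _)).
rewrite /limn_esup limf_esupE; apply/lee_addgt0Pr => e e0; rewrite add0e.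
(* Beyond both N and |K| / e, so that a n <= |K| <= e n for all n >= M. *)
pose M := (maxn N (Num.truncn (`|K| / e)).+1).
apply: (@le_trans _ _ (ereal_sup ((fun n => (n%:R^-1 * a n)%:E) @` [set n | (M <= n)%N]))).
  by apply: ereal_inf_lbound; exists [set n | (M <= n)%N] => //; exists M.
apply: ub_ereal_sup => _ [n /= Mn <-]; rewrite lee_fin.
have Nn : (N <= n)%N by rewrite (leq_trans _ Mn) // leq_maxl.
have Tn : ((Num.truncn (`|K| / e)).+1 <= n)%N by rewrite (leq_trans _ Mn) // leq_maxr.
have n0 : 0 < n%:R :> R by rewrite ltr0n (leq_trans _ Tn).
rewrite mulrC ler_pdivrMr // (le_trans (aK _ Nn)) // (le_trans (ler_norm K)) //.
rewrite mulrC -ler_pdivrMr //; apply/ltW/(lt_le_trans (truncnS_gt _)).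
by rewrite ler_nat.
Qed.

Section LimInf.
Context {R : realType} (c : params R).
Local Notation R3 := (R * R * R)%type.
Local Notation F := (F c).
Local Notation Lambda := (Lambda c).
Implicit Types p : R3.

Lemma central_deriv_logistic p : Lambda p ->
  central_deriv c p * (p.1.2 * (1 - p.1.2)) <= (F p).1.2 * (1 - (F p).1.2).
Proof.
case/Lambda_bounds=> _ y01 _; rewrite F_y /central_deriv; case: ifP => _.
  by rewrite fiber_deriv_logistic.
exact/contr_deriv_logistic/sigma_bounds.
Qed.

Lemma central_deriv_iter_logistic n p : Lambda p ->
  central_deriv_iter c n p * (p.1.2 * (1 - p.1.2)) <=
  (iter n F p).1.2 * (1 - (iter n F p).1.2).
Proof.
move=> Lp; elim: n => [|n IH]; first by rewrite /central_deriv_iter big_ord0 mul1r.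
rewrite central_deriv_iterS iterS.
apply: le_trans (central_deriv_logistic (Lambda_iter n Lp)).
by rewrite mulrAC mulrC ler_pM2l // central_deriv_gt0 //; exact: Lambda_iter.
Qed.

(** A visit to z > 1/6 would send y = 0 to y = sigma > 0, so only the first branch is used, and it
    is linear in x and z. *)
Lemma iter_F_y0 p n : (forall k, (iter k F p).1.2 = 0) -> Lambda p ->
  iter n F p = (lam0 c ^+ n * p.1.1, 0, beta0 c ^+ n * p.2).
Proof.
move=> y0 Lp.
have z6 k : (iter k F p).2 <= 1 / 6.
  rewrite leNgt; apply/negP => z6.
  have := y0 k.+1; rewrite iterS F_y leNgt z6 /= y0 subr0 mulr1.
  by apply/eqP; rewrite gt_eqF //; case/andP: (sigma_bounds c).
have := y0 n; elim: n => [|n IH] yn.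
  by case: p Lp y0 z6 yn => [[x y] z] _ _ _ /= ->; rewrite !expr0 !mul1r.
have := F_x c (iter n F p); have := F_z c (iter n F p); rewrite !z6 -iterS.
case: (iter n.+1 F p) yn => [[x y] z] /= -> -> ->.
by rewrite (IH (y0 n)) /= !exprS !mulrA.
Qed.

(** On such an orbit z is multiplied by [beta0 c] > 6 at each step while it stays in [0, 1], so it
    starts at 0. *)
Lemma stable_Q_central p : Lambda p -> (forall k, (iter k F p).1.2 = 0) ->
  p.1.2 = 0 /\ p.2 = 0.
Proof.
move=> Lp y0; split; first exact: (y0 0).
have [_ _ z01] := Lambda_bounds Lp.
have z0 : 0 <= p.2 by case/orP: z01 => /andP[]; lra.
apply/eqP; rewrite -[_ == _]negbK; apply/negP => zn.
have {z0 zn z01} z0 : 0 < p.2 by rewrite lt_neqAle eq_sym zn.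
have b1 : 2 <= beta0 c by have := beta0_bounds c; lra.
(* Through n <= 2 ^ n <= beta0 ^ n. *)
have H n : n%:R * p.2 <= 1.
  have := Lambda_bounds (Lambda_iter n Lp); rewrite iter_F_y0 //= => -[_ _ zn].
  apply: (@le_trans _ _ (beta0 c ^+ n * p.2)); last by lra.
  rewrite ler_pM2r // (@le_trans _ _ (2 ^+ n)) //; last by apply: lerXn2r; rewrite ?nnegrE; lra.
  by rewrite -natrX ler_nat ltnW // ltn_expl.
have := H (Num.truncn p.2^-1).+1; apply/negP; rewrite -ltNge.
by rewrite -ltr_pdivrMr // mul1r truncnS_gt.
Qed.

Lemma liminf_central_exponent p : Lambda p -> recurrent c p -> p <> Q ->
  (limn_einf (fun n : nat => (n%:R^-1 * ln (DFc c n p))%:E) <= 0)%E.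
Proof.
move=> Lp [u uoo ucvg] pQ.
under eq_fun do rewrite DFcE //.
have [[m ym]|nointer] := pselect (exists m, 0 < (iter m F p).1.2 < 1).
  set q := iter m F p in ym.
  have X0 : 0 < q.1.2 * (1 - q.1.2) by case/andP: ym => ? ?; rewrite mulr_gt0 // subr_gt0.
  (* Once the orbit is at q with X q > 0, telescoping [central_deriv_logistic] and X <= 1 bound the
     derivative from q on by 1 / X q, uniformly in time. *)
  pose K := central_deriv_iter c m p / (q.1.2 * (1 - q.1.2)).
  apply: (@limn_einf_div_le0 _ _ (ln K) m) => n mn.
  apply: ler_ln_pos; first exact: central_deriv_iter_gt0.
  rewrite -(subnKC mn) central_deriv_iterD /K ler_pM2l ?central_deriv_iter_gt0 //.
  rewrite -[leRHS]mul1r ler_pdivlMr //.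
  apply: le_trans (central_deriv_iter_logistic _ (Lambda_iter m Lp)) _.
  have [_ /andP[? ?] _] := Lambda_bounds (Lambda_iter (n - m) (Lambda_iter m Lp)).
  by nra.
have dich n : (iter n F p).1.2 = 0 \/ (iter n F p).1.2 = 1.
  have [_ /andP[y0 y1] _] := Lambda_bounds (Lambda_iter n Lp).
  have [->|yn0] := eqVneq (iter n F p).1.2 0; first by left.
  have [->|yn1] := eqVneq (iter n F p).1.2 1; first by right.
  by case: nointer; exists n; rewrite !lt_neqAle y0 y1 eq_sym yn0 yn1.
have [[m ym]|all1] := pselect (exists m, (iter m F p).1.2 = 0).
  exfalso; apply: pQ.
  (* Leaving y = 0 would produce y = sigma, which lies strictly between 0 and 1, against [dich]. *)
  have y0 k : (iter k F (iter m F p)).1.2 = 0.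
    elim: k => [//|k IH]; rewrite iterS F_y IH fiber_map0 subr0 mulr1.
    case: ifP => // z6; have := dich (k + m).+1.
    rewrite iterS iterD F_y IH subr0 mulr1 z6; have /andP[] := sigma_bounds c; lra.
  have Lq := Lambda_iter m Lp.
  have [_ z0] := stable_Q_central Lq y0.
  have itn n : iter (n + m) F p = (lam0 c ^+ n * (iter m F p).1.1, 0, 0).
    by rewrite iterD iter_F_y0 // z0 mulr0.
  have lamc : lam0 c ^+ n * (iter m F p).1.1 @[n --> \oo] --> (0 : R).
    rewrite -(mul0r (iter m F p).1.1); apply: cvgM; last exact: cvg_cst.
    by apply: cvg_expr; have /andP[? ?] := lam0_bounds c; rewrite ger0_norm; lra.
  have gcvg : iter (n + m) F p @[n --> \oo] --> (Q : R3).
    under eq_fun do rewrite itn.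
    apply: (@cvg_pair _ _ _ _ (nbhs ((0 : R), (0 : R))) (nbhs (0 : R))); last exact: cvg_cst.
    by apply: (@cvg_pair _ _ _ _ (nbhs (0 : R)) (nbhs (0 : R))) => //; exact: cvg_cst.
  (* The whole orbit tends to Q, and so does every subsequence; recurrence then gives p = Q by
     uniqueness of limits. *)
  have icvg : iter n F p @[n --> \oo] --> (Q : R3).
    apply: cvg_trans (cvg_comp _ _ (cvg_subnr m) gcvg).
    by apply: near_eq_cvg; near=> n; rewrite /= subnK //; near: n; exists m.
  apply: (cvg_unique _ ucvg); first exact: norm_hausdorff.
  exact: (cvg_comp _ _ uoo icvg).
(* The orbit stays on y = 1, where every factor is 1 / e or sigma, hence at most 1. *)
apply: (@limn_einf_div_le0 _ _ 0 0) => n _.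
rewrite -ln1; apply: ler_ln_pos; first exact: central_deriv_iter_gt0.
elim: n => [|n IH]; first by rewrite /central_deriv_iter big_ord0.
rewrite central_deriv_iterS -[leRHS]mulr1.
have Ln := Lambda_iter n Lp.
apply: ler_pM => //; try exact/ltW/central_deriv_gt0.
  exact/ltW/central_deriv_iter_gt0.
rewrite /central_deriv; case: ifP => _; last by have := sigma_bounds c; lra.
have [yn|->] := dich n; first by case: all1; exists n.
rewrite /fiber_denom subrr mul0r addr0 expr1n divr1.
by have := @expRN1_bounds R; lra.
Unshelve. all: by end_near. Qed.

End LimInf.

(** * Compactness and measurability *)

Section Borel.
Context {R : realType}.
Local Notation R3 := (R * R * R)%type.

Lemma ball_rat (x : R) (e : R) : 0 < e -> exists q : rat, ball (ratr q : R) e x.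
Proof.
move=> e0; have xe : x < x + e by rewrite ltrDl.
have [q] := rat_in_itvoo xe; rewrite in_itv /= => /andP[q1 q2].
by exists q; rewrite /ball /= ltr_norml; apply/andP; split; lra.
Qed.

(** An open set is the union of the countably many cubes with rational centre and radius 1 / (n + 1)
    that it contains. This is what makes the product sigma-algebra contain the Borel sets. *)
Lemma open_measurable_R3 (A : set R3) : open A -> measurable A.
Proof.
move=> oA.
pose B (i : rat * rat * rat * nat) : set R3 :=
  ball (ratr i.1.1.1 : R) (i.2.+1%:R^-1) `*` ball (ratr i.1.1.2 : R) (i.2.+1%:R^-1) `*`
  ball (ratr i.1.2 : R) (i.2.+1%:R^-1).
have -> : A = \bigcup_i (if `[< B i `<=` A >] then B i else set0).
  apply/seteqP; split=> [p Ap|p [i _]]; last by case: asboolP => // BA /BA.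
  have /nbhs_ballP[e /= e0 eA] : nbhs p A by exact: open_nbhs_nbhs.
  have e20 : 0 < e / 2 by rewrite divr_gt0.
  pose n := Num.truncn (e / 2)^-1; have n0 : (0 : R) < n.+1%:R^-1 by rewrite invr_gt0.
  have ne : n.+1%:R^-1 <= e / 2.
    by rewrite -[leRHS]invrK lef_pV2 ?posrE ?invr_gt0 // ltW // truncnS_gt.
  have [q1 Hq1] := ball_rat p.1.1 n0.
  have [q2 Hq2] := ball_rat p.1.2 n0.
  have [q3 Hq3] := ball_rat p.2 n0.
  have Bp : B (q1, q2, q3, n) p by [].
  exists (q1, q2, q3, n) => //; case: asboolP => // -[] s [[s1 s2] s3]; apply: eA.
  have H (q u v : R) : ball q (n.+1%:R^-1 : R) u -> ball q (n.+1%:R^-1 : R) v -> ball u e v.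
    move=> /ball_sym qu qv; apply: le_ball (ball_triangle qu qv).
    by rewrite [leRHS]splitr lerD.
  by split; [split|]; [exact: H Hq1 s1|exact: H Hq2 s2|exact: H Hq3 s3].
apply: countable_bigcupT_measurable => [|i]; first exact: countableP.
case: asboolP => // _; apply: measurableX; first apply: measurableX.
all: exact: measurable_ball.
Qed.

Lemma closed_measurable_R3 (A : set R3) : closed A -> measurable A.
Proof. by move=> /closed_openC/open_measurable_R3/measurableC; rewrite setCK. Qed.

Lemma within_continuous_measurable_R3 (A : set R3) (g : R3 -> R) :
  closed A -> {within A, continuous g} -> measurable_fun A g.
Proof.
move=> cA /continuousP cg; apply: (measurability _ (RGenOpens.measurableE R)).
move=> _ [_ [a [b ->] <-]].
have oab : open `]a, b[%classic by exact: interval_open.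
have [V oV VA] := (open_subspaceP _ _).1 (cg _ oab).
by rewrite setIC -VA; apply: measurableI; [exact: open_measurable_R3|exact: closed_measurable_R3].
Qed.

Lemma closed_eq_continuous (T : topologicalType) (f g : T -> R) :
  continuous f -> continuous g -> closed [set x | f x = g x].
Proof.
move=> cf cg.
have -> : [set x | f x = g x] = (f \- g) @^-1` [set 0].
  by apply/seteqP; split=> x /=; [move=> ->; rewrite subrr|move/eqP; rewrite subr_eq0 => /eqP].
apply: preimage_closed; last exact: closed_eq.
by move=> x _; apply: continuousB; [exact: cf|exact: cg].
Qed.

End Borel.

(** * Compactness of [Lambda] through the space of full orbits *)

Section CompactLambda.
Context {R : realType} (c : params R).
Local Notation R3 := (R * R * R)%type.
Local Notation orbits := (prod_topology (fun _ : int => R3)).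
Local Notation F := (F c).
Local Notation Lambda := (Lambda c).

Lemma R3_ext (p q : R3) : p.1.1 = q.1.1 -> p.1.2 = q.1.2 -> p.2 = q.2 -> p = q.
Proof. by case: p q => [[? ?] ?] [[? ?] ?] /= -> -> ->. Qed.

Lemma compact_slabs : compact (@slab0 R `|` @slab1 R).
Proof.
by apply: compactU; apply: compact_setX; try apply: compact_setX; exact: segment_compact.
Qed.

Lemma orbit_at_continuous k : continuous (fun w : orbits => w k : R3).
Proof. exact: (@proj_continuous _ (fun _ : int => R3) k). Qed.

Lemma orbit_xy_continuous k : continuous (fun w : orbits => (w k).1).
Proof.
move=> w; apply: (@continuous_comp _ _ _ (fun w : orbits => w k : R3) fst).
  exact: orbit_at_continuous.
exact: cvg_fst.
Qed.

Lemma orbit_x_continuous k : continuous (fun w : orbits => (w k).1.1).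
Proof.
move=> w; apply: (@continuous_comp _ _ _ (fun w : orbits => (w k).1) fst).
  exact: orbit_xy_continuous.
exact: cvg_fst.
Qed.

Lemma orbit_y_continuous k : continuous (fun w : orbits => (w k).1.2).
Proof.
move=> w; apply: (@continuous_comp _ _ _ (fun w : orbits => (w k).1) snd).
  exact: orbit_xy_continuous.
exact: cvg_snd.
Qed.

Lemma orbit_z_continuous k : continuous (fun w : orbits => (w k).2).
Proof.
move=> w; apply: (@continuous_comp _ _ _ (fun w : orbits => w k : R3) snd).
  exact: orbit_at_continuous.
exact: cvg_snd.
Qed.

(** F is discontinuous, but its graph over the two disjoint slabs is a union of two pieces, each cut
    out by equations between continuous functions. *)
Lemma closed_graph k :
  closed [set w : orbits | (@slab0 R `|` @slab1 R) (w k) /\ w (k + 1) = F (w k)].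
Proof.
have cx := orbit_x_continuous; have cy := orbit_y_continuous; have cz := orbit_z_continuous.
(* The equation for y is multiplied by the denominator of [fiber_map], which
   vanishes at a point outside [0, 1]. *)
pose G0 := [set w : orbits | @slab0 R (w k)] `&`
  [set w : orbits | (w (k + 1)).1.1 = lam0 c * (w k).1.1] `&`
  [set w : orbits | (w (k + 1)).1.2 * fiber_denom (w k).1.2 = (w k).1.2] `&`
  [set w : orbits | (w (k + 1)).2 = beta0 c * (w k).2].
pose G1 := [set w : orbits | @slab1 R (w k)] `&`
  [set w : orbits | (w (k + 1)).1.1 = 3 / 4 - lam1 c * (w k).1.1] `&`
  [set w : orbits | (w (k + 1)).1.2 = sigma c * (1 - (w k).1.2)] `&`
  [set w : orbits | (w (k + 1)).2 = beta1 c * ((w k).2 - 5 / 6)].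
have -> : [set w : orbits | (@slab0 R `|` @slab1 R) (w k) /\ w (k + 1) = F (w k)] = G0 `|` G1.
  apply/seteqP; split=> w /=.
    move=> [Sw wE]; move: (Sw).
    have := F_x c (w k); have := F_y c (w k); have := F_z c (w k); rewrite -wE.
    case: ifP => z6 wz wy wx [] Sk.
    - left; do !split=> //=; rewrite wy fiber_mapE mulfVK // gt_eqF //.
      by apply: fiber_denom_gt0; case/slabsP: Sw.
    - by exfalso; case: Sk => _ /=; rewrite in_itv /=; lra.
    - by exfalso; case: Sk => _ /=; rewrite in_itv /=; lra.
    - by right.
  case=> -[[[/= Sw wx] wy] wz].
    have S01 : (@slab0 R `|` @slab1 R) (w k) by left.
    split=> //; have [_ y01 _] := slabsP S01.
    have z6 : (w k).2 <= 1 / 6 by case: Sw => _ /=; rewrite in_itv /=; lra.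
    apply: R3_ext; rewrite ?F_x ?F_y ?F_z z6 //.
    by rewrite fiber_mapE -[X in _ = X / _]wy mulfK // gt_eqF // fiber_denom_gt0.
  have S01 : (@slab0 R `|` @slab1 R) (w k) by right.
  split=> //.
  have z6 : (w k).2 <= 1 / 6 = false.
    by apply/negbTE; rewrite -ltNge; case: Sw => _ /=; rewrite in_itv /=; lra.
  by apply: R3_ext; rewrite ?F_x ?F_y ?F_z z6.
have mulc (a b : orbits -> R) : continuous a -> continuous b -> continuous (fun w => a w * b w).
  by move=> ca cb w; apply: continuousM; [exact: ca|exact: cb].
have addc (a b : orbits -> R) : continuous a -> continuous b -> continuous (fun w => a w + b w).
  by move=> ca cb w; apply: continuousD; [exact: ca|exact: cb].
have oppc (a : orbits -> R) : continuous a -> continuous (fun w => - a w).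
  by move=> ca w; apply: continuousN; exact: ca.
have cstc (a : R) : continuous (fun _ : orbits => a) by exact: cst_continuous.
have closed_slab (A : set R3) : compact A -> closed [set w : orbits | A (w k)].
  move=> cA; apply: (preimage_closed (f := fun w : orbits => w k : R3)).
    by move=> w _; exact: orbit_at_continuous.
  by apply: compact_closed => //; exact: norm_hausdorff.
have cD : continuous (fun w : orbits => fiber_denom (w k).1.2).
  apply: (addc _ _); first exact: cy.
  apply: (mulc (fun w => 1 - (w k).1.2) (fun=> expR (-1))); last exact: cstc.
  by apply: (addc _ _); [exact: cstc|apply: oppc; exact: cy].
have cs0 : closed [set w : orbits | @slab0 R (w k)].
  by apply: (closed_slab _); do 2?apply: compact_setX; exact: segment_compact.
have cs1 : closed [set w : orbits | @slab1 R (w k)].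
  by apply: (closed_slab _); do 2?apply: compact_setX; exact: segment_compact.
apply: closedU; (apply: closedI; [apply: closedI; [apply: closedI|]|]).
- exact: cs0.
- exact: (closed_eq_continuous (cx _) (mulc _ _ (cstc _) (cx k))).
- exact: (closed_eq_continuous (mulc _ _ (cy _) cD) (cy k)).
- exact: (closed_eq_continuous (cz _) (mulc _ _ (cstc _) (cz k))).
- exact: cs1.
- exact: (closed_eq_continuous (cx _) (addc _ _ (cstc _) (oppc _ (mulc _ _ (cstc _) (cx k))))).
- exact: (closed_eq_continuous (cy _) (mulc _ _ (cstc _) (addc _ _ (cstc _) (oppc _ (cy k))))).
- exact: (closed_eq_continuous (cz _) (mulc _ _ (cstc _) (addc _ _ (cz k) (cstc _)))).
Qed.

(** [Lambda] is the image, under evaluation at time 0, of the space of full orbits. That space is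
    closed in a product of copies of the compact slabs, which is compact by Tychonoff. *)
Lemma compact_Lambda : compact Lambda.
Proof.
pose K := [set w : orbits | forall k, (@slab0 R `|` @slab1 R) (w k)].
pose C := \bigcap_(k : int) [set w : orbits | (@slab0 R `|` @slab1 R) (w k) /\ w (k + 1) = F (w k)].
have -> : Lambda = (fun w : orbits => w 0 : R3) @` (K `&` C).
  apply/seteqP; split=> [p [w [w0 wS wF]]|_ [w [wS wF] <-]].
    by exists w => //; split=> // k _; split.
  by exists w; split=> // k; case: (wF k I).
apply: continuous_compact.
  by apply: continuous_subspaceT => w; exact: orbit_at_continuous.
apply: compact_closedI; last by apply: closed_bigI => k _; exact: closed_graph.
by apply: (@tychonoff _ (fun _ : int => R3) (fun=> @slab0 R `|` @slab1 R)) => k; exact: compact_slabs.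
Qed.

Lemma closed_Lambda : closed Lambda.
Proof. by apply: compact_closed; [exact: norm_hausdorff|exact: compact_Lambda]. Qed.

Lemma measurable_Lambda : measurable (Lambda : set R3).
Proof. by apply: closed_measurable_R3; exact: closed_Lambda. Qed.

End CompactLambda.

(** * Measurability of F and the algebra of test functions bounded on [Lambda] *)

Section Measurability.
Context {R : realType} (c : params R).
Local Notation R3 := (R * R * R)%type.
Local Notation F := (F c).
Local Notation Lambda := (Lambda c).

Lemma measurable_invr : measurable_fun [set: R] (fun x : R => x^-1).
Proof.
have -> : [set: R] = [set 0] `|` ~` [set 0] by rewrite setUv.
apply/measurable_funU => //; first exact: measurableC.
split; first exact: measurable_fun_set1.
apply: open_continuous_measurable_fun; first by rewrite openC; exact: closed_eq.
by move=> x; rewrite inE /= => /eqP x0; exact: inv_continuous.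
Qed.

Lemma measurable_x : measurable_fun [set: R3] (fun p : R3 => p.1.1).
Proof. exact: (measurableT_comp measurable_fst measurable_fst). Qed.

Lemma measurable_y : measurable_fun [set: R3] (fun p : R3 => p.1.2).
Proof. exact: (measurableT_comp measurable_snd measurable_fst). Qed.

Lemma measurable_z : measurable_fun [set: R3] (fun p : R3 => p.2).
Proof. exact: measurable_snd. Qed.

Lemma measurable_div (v w : R3 -> R) : measurable_fun setT v ->
  measurable_fun setT w -> measurable_fun setT (fun p => v p / w p).
Proof.
move=> mv mw; apply: measurable_funM => //.
exact: (measurableT_comp measurable_invr mw).
Qed.

Lemma measurable_branch d (T : measurableType d) (v w : R3 -> T) :
  measurable_fun setT v -> measurable_fun setT w ->
  measurable_fun setT (fun p : R3 => if p.2 <= 1 / 6 then v p else w p).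
Proof.
move=> mv mw; apply: measurable_fun_ifT => //.
by apply: measurable_fun_ler => //; exact: measurable_z.
Qed.

Lemma measurable_fiber_denom (v : R3 -> R) : measurable_fun setT v ->
  measurable_fun setT (fun p => fiber_denom (v p)).
Proof.
move=> mv; apply: measurable_funD => //; apply: measurable_funM => //.
exact: measurable_funB.
Qed.

Lemma measurable_F : measurable_fun [set: R3] F.
Proof.
have -> : F = (fun p : R3 => if p.2 <= 1 / 6
  then (lam0 c * p.1.1, p.1.2 / fiber_denom p.1.2, beta0 c * p.2)
  else (3 / 4 - lam1 c * p.1.1, sigma c * (1 - p.1.2), beta1 c * (p.2 - 5 / 6))).
  by apply/funext => -[[x y] z].
have mx := measurable_x; have my := measurable_y; have mz := measurable_z.
apply: measurable_branch; do 2?apply: measurable_fun_pair.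
- exact: measurable_funM.
- by apply: measurable_div => //; exact: measurable_fiber_denom.
- exact: measurable_funM.
- by apply: measurable_funB => //; exact: measurable_funM.
- by apply: measurable_funM => //; exact: measurable_funB.
- by apply: measurable_funM => //; exact: measurable_funB.
Qed.

(* Boundedness is only required on [Lambda], which carries all the measures. *)
Definition bounded_meas (v : R3 -> R) :=
  measurable_fun setT v /\ exists M, forall p, Lambda p -> `|v p| <= M.

Lemma bm_cst (a : R) : bounded_meas (fun=> a).
Proof. by split; [|exists `|a|]. Qed.

Lemma bmD v w : bounded_meas v -> bounded_meas w -> bounded_meas (fun p => v p + w p).
Proof.
move=> [mv [M vM]] [mw [N wN]]; split; first exact: measurable_funD.
exists (M + N) => p Lp; apply: (le_trans (ler_normD _ _)).
by apply: lerD; [exact: vM|exact: wN].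
Qed.

Lemma bmM v w : bounded_meas v -> bounded_meas w -> bounded_meas (fun p => v p * w p).
Proof.
move=> [mv [M vM]] [mw [N wN]]; split; first exact: measurable_funM.
by exists (M * N) => p Lp; rewrite normrM ler_pM ?vM ?wN.
Qed.

Lemma bmN v : bounded_meas v -> bounded_meas (fun p => - v p).
Proof.
move=> [mv [M vM]]; split; first exact: measurableT_comp.
by exists M => p Lp; rewrite normrN vM.
Qed.

Lemma bmB v w : bounded_meas v -> bounded_meas w -> bounded_meas (fun p => v p - w p).
Proof. by move=> bv bw; apply: bmD => //; exact: bmN. Qed.

Lemma bm_F v : bounded_meas v -> bounded_meas (v \o F).
Proof.
move=> [mv [M vM]]; split; first exact: (measurableT_comp mv measurable_F).
by exists M => p Lp; apply: vM; exact: Lambda_F.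
Qed.

Lemma bm_branch v w : bounded_meas v -> bounded_meas w ->
  bounded_meas (fun p => if p.2 <= 1 / 6 then v p else w p).
Proof.
move=> [mv [M vM]] [mw [N wN]]; split; first exact: measurable_branch.
by exists (Num.max M N) => p Lp; case: ifP => _; rewrite le_max ?vM ?wN ?orbT.
Qed.

Lemma bm_div v w (m : R) : bounded_meas v -> measurable_fun setT w -> 0 < m ->
  (forall p, Lambda p -> m <= w p) -> bounded_meas (fun p => v p / w p).
Proof.
move=> [mv [M vM]] mw m0 wm; split; first exact: measurable_div.
exists (M / m) => p Lp; have w0 : 0 < w p by rewrite (lt_le_trans m0) ?wm.
by rewrite normrM normfV (gtr0_norm w0) ler_pM ?vM ?invr_ge0 ?(ltW w0) // lef_pV2 ?posrE ?wm.
Qed.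

Lemma bm_ln v (m : R) : bounded_meas v -> 0 < m ->
  (forall p, Lambda p -> m <= v p) -> bounded_meas (fun p => ln (v p)).
Proof.
move=> [mv [M vM]] m0 vm; split; first exact: (measurableT_comp (@measurable_ln R) mv).
exists (`|ln m| + `|ln M|) => p Lp; have v0 : 0 < v p by rewrite (lt_le_trans m0) ?vm.
have H1 : ln m <= ln (v p) by apply: ler_ln_pos => //; exact: vm.
have H2 : ln (v p) <= ln M.
  by apply: ler_ln_pos => //; apply: le_trans (vM _ Lp); rewrite ler_norm.
have := ler_norm (ln M); have := ler_norm (- ln m); rewrite normrN.
have := normr_ge0 (ln m); have := normr_ge0 (ln M).
by rewrite ler_norml => *; apply/andP; split; lra.
Qed.

Lemma bm_x : bounded_meas (fun p => p.1.1).
Proof.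
split; first exact: measurable_x.
by exists 1 => p /Lambda_bounds[/andP[? ?] _ _]; rewrite ger0_norm.
Qed.

Lemma bm_y : bounded_meas (fun p => p.1.2).
Proof.
split; first exact: measurable_y.
by exists 1 => p /Lambda_bounds[_ /andP[? ?] _]; rewrite ger0_norm.
Qed.

Lemma bm_z : bounded_meas (fun p => p.2).
Proof.
split; first exact: measurable_z.
by exists 1 => p /Lambda_bounds[_ _ z01]; rewrite ger0_norm; lra.
Qed.

End Measurability.

(** * Means of bounded coboundaries *)

Section Mean.
Context {R : realType} (c : params R).
Local Notation R3 := (R * R * R)%type.
Local Notation F := (F c).
Local Notation Lambda := (Lambda c).
Local Notation bounded_meas := (bounded_meas c).
Variable mu : probability R3 R.
Hypothesis muI : invariant_measure c mu.

Definition mean (v : R3 -> R) : R := \int[mu]_(p in Lambda) v p.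

Lemma bounded_meas_integrable v : bounded_meas v ->
  mu.-integrable Lambda (EFin \o v).
Proof.
move=> [mv [M vM]]; apply: measurable_bounded_integrable.
- exact: measurable_Lambda.
- by rewrite (_ : _ Lambda = 1%E) ?ltry //; exact: muI.1.
- exact: measurable_funTS.
- exists M; split; first exact: num_real.
  by move=> N MN p Lp; apply: (le_trans (vM _ Lp)); exact: ltW.
Qed.

Lemma mean_le v w : bounded_meas v -> bounded_meas w ->
  (forall p, Lambda p -> v p <= w p) -> mean v <= mean w.
Proof.
move=> bv bw vw; apply: le_Rintegral => //; first exact: measurable_Lambda.
  exact: bounded_meas_integrable.
exact: bounded_meas_integrable.
Qed.

Lemma mean_eq v w : (forall p, Lambda p -> v p = w p) -> mean v = mean w.
Proof. by move=> vw; rewrite /mean; apply: eq_Rintegral => p; rewrite inE => /vw. Qed.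

Lemma mean_cst a : mean (fun=> a) = a.
Proof.
rewrite /mean Rintegral_cst; last exact: measurable_Lambda.
by rewrite (_ : _ Lambda = 1%E) ?mulr1 //; exact: muI.1.
Qed.

Lemma meanD v w : bounded_meas v -> bounded_meas w ->
  mean (fun p => v p + w p) = mean v + mean w.
Proof.
by move=> bv bw; apply: RintegralD; [exact: measurable_Lambda|exact: bounded_meas_integrable..].
Qed.

Lemma meanB v w : bounded_meas v -> bounded_meas w ->
  mean (fun p => v p - w p) = mean v - mean w.
Proof.
by move=> bv bw; apply: RintegralB; [exact: measurable_Lambda|exact: bounded_meas_integrable..].
Qed.

Lemma meanZ a v : bounded_meas v -> mean (fun p => a * v p) = a * mean v.
Proof.
by move=> bv; apply: RintegralZl; [exact: measurable_Lambda|exact: bounded_meas_integrable].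
Qed.

Lemma mean_ge0 v : (forall p, Lambda p -> 0 <= v p) -> 0 <= mean v.
Proof. by move=> v0; apply: Rintegral_ge0. Qed.

Lemma measure_Lambda_setC : mu (~` Lambda) = 0%E.
Proof.
rewrite probability_setC; last exact: measurable_Lambda.
by rewrite (_ : _ Lambda = 1%E) ?subee //; exact: muI.1.
Qed.

(** Invariance is stated for preimages inside [Lambda]; the complement of [Lambda] is null, so mu is
    preserved on the whole space. *)
Lemma measure_F_preimage A : measurable A -> mu (F @^-1` A) = mu A.
Proof.
move=> mA; rewrite -(muI.2 _ mA).
have mFA : measurable (F @^-1` A) by rewrite -[_ @^-1` _]setTI; exact: measurable_F.
have mL := measurable_Lambda c; have mLC := measurableC mL.
have N0 : mu (F @^-1` A `&` ~` Lambda) = 0%E.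
  apply: (@subset_measure0 _ _ _ _ _ (~` Lambda)) => //.
  - exact: measurableI.
  - exact: measure_Lambda_setC.
rewrite -[in LHS](setIT (F @^-1` A)) -(setUv Lambda) setIUr measureU //.
- by rewrite [X in (_ + X)%E]N0 adde0 setIC.
- exact: measurableI.
- exact: measurableI.
- by rewrite setIACA setICr setI0.
Qed.

Lemma mean_setT v : mu.-integrable setT (EFin \o v) -> mean v = \int[mu]_p v p.
Proof.
move=> iv; rewrite /mean /Rintegral.
rewrite [in RHS](@negligible_integral _ _ _ mu setT (~` Lambda)) //.
- by rewrite setTD setCK.
- by apply: measurableC; exact: measurable_Lambda.
- exact: measure_Lambda_setC.
Qed.

Lemma mean_F v : bounded_meas v -> mean (v \o F) = mean v.
Proof.
(* Setting v to 0 off [Lambda] makes it bounded everywhere, as the change of variables on the whole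
   space requires. Means over [Lambda] are unchanged, also after composition with F, which maps
   [Lambda] into itself. *)
move=> [mv [M vM]]; pose w := v \_ Lambda.
have mw : measurable_fun setT w.
  by apply/(measurable_restrictT _ _).1; [exact: measurable_Lambda|exact: measurable_funTS].
have wM p : `|w p| <= `|M|.
  rewrite /w patchE; case: ifPn; rewrite ?normr0 // inE => Lp.
  by apply: (le_trans (vM _ Lp)); exact: ler_norm.
have iw (u : R3 -> R) : measurable_fun setT u -> (forall p, `|u p| <= `|M|) ->
    mu.-integrable setT (EFin \o u).
  move=> mu_ uM; apply: measurable_bounded_integrable => //.
    by rewrite (_ : _ setT = 1%E) ?ltry //; exact: (probability_setT mu).
  exists `|M|; split; first exact: num_real.
  by move=> N MN p _; apply: (le_trans (uM p)); exact: ltW.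
have mwF : measurable_fun setT (w \o F) by exact: (measurableT_comp mw (measurable_F c)).
have -> : mean v = mean w.
  by apply: mean_eq => p Lp; rewrite /w patchE mem_set.
have -> : mean (v \o F) = mean (w \o F).
  by apply: mean_eq => p Lp; rewrite /w /= patchE mem_set //; exact: Lambda_F.
rewrite !mean_setT //; try by apply: iw => // p; exact: wM.
rewrite /Rintegral; congr fine.
have := @integral_pushforward _ _ _ _ R F (measurable_F c) mu setT (EFin \o w).
rewrite preimage_setT => /(_ _ _ measurableT) <- //.
- apply: eq_measure_integral; first exact: measurable_F.
  by move=> mF A mA _; exact: measure_F_preimage.
- exact/measurable_EFinP.
- by apply: (iw (w \o F)) => // p; exact: wM.
Qed.

(** The tool behind the integral estimates below: each comes from a choice of the transfer function
    v, since v o F - v has mean zero. *)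
Lemma mean_coboundary v w : bounded_meas v -> bounded_meas w ->
  (forall p, Lambda p -> w p <= v (F p) - v p) -> mean w <= 0.
Proof.
move=> bv bw wv; have bvF := bm_F bv.
apply: (@le_trans _ _ (mean (fun p => (v \o F) p - v p))).
  by apply: mean_le => //; exact: bmB.
by rewrite meanB // mean_F // subrr.
Qed.

End Mean.

Ltac bm := repeat first
  [ assumption | exact: bm_cst | exact: bm_x | exact: bm_y | exact: bm_z
  | apply: bmB | apply: bmD | apply: bmM | apply: bmN ].

(** * Estimates for invariant measures *)

Section Estimates.
Context {R : realType} (c : params R).
Local Notation R3 := (R * R * R)%type.
Local Notation F := (F c).
Local Notation Lambda := (Lambda c).
Local Notation bounded_meas := (bounded_meas c).
Variable mu : probability R3 R.
Hypothesis muI : invariant_measure c mu.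
Local Notation mean := (mean c mu).
Implicit Types p : R3.

Definition in_slab1 p : R := if p.2 <= 1 / 6 then 0 else 1.

Lemma bm_in_slab1 : bounded_meas in_slab1.
Proof. by apply: bm_branch; exact: bm_cst. Qed.
Let bS := bm_in_slab1.

Lemma bm_ln_central_deriv : bounded_meas (fun p => ln (central_deriv c p)).
Proof.
have e0 := expR_gt0 (-1 : R).
have s0 : 0 < sigma c by case/andP: (sigma_bounds c).
have D2 p : Lambda p -> expR (-1) ^+ 2 <= fiber_denom p.1.2 ^+ 2 <= 1.
  case/Lambda_bounds => _ /fiber_denom_bounds[D1 D2 D3] _.
  by rewrite lerXn2r ?nnegrE ?(ltW e0) ?(ltW D3) //= expr_le1 // ltW.
apply: (@bm_ln _ _ _ (Num.min (expR (-1)) (sigma c))).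
- apply: bm_branch; last exact: bm_cst.
  apply: (@bm_div _ _ _ _ (expR (-1) ^+ 2)); first exact: bm_cst.
  + by apply: measurable_funX; apply: measurable_fiber_denom; exact: measurable_y.
  + by rewrite exprn_gt0.
  + by move=> p /D2/andP[].
- by rewrite lt_min e0.
- move=> p Lp; rewrite /central_deriv ge_min; case: ifP => _; last by rewrite lexx orbT.
  have /andP[D1 D3] := D2 _ Lp; have D0 := lt_le_trans (exprn_gt0 2 e0) D1.
  by rewrite ler_pdivlMr // ler_piMr ?(ltW e0).
Qed.
Let bL := bm_ln_central_deriv.

Lemma bm_shift_inv q dl : bounded_meas q -> (forall p, Lambda p -> 0 <= q p) -> 0 < dl ->
  bounded_meas (fun p => dl / (q p + dl)).
Proof.
move=> bq q0 dl0; apply: (@bm_div _ _ _ _ dl) => //; first exact: bm_cst.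
  by have [] : bounded_meas (fun p => q p + dl) by bm.
by move=> p Lp; rewrite lerDr q0.
Qed.

Lemma Lambda_y_ge0 p : Lambda p -> 0 <= p.1.2.
Proof. by case/Lambda_bounds => _ /andP[]. Qed.

Lemma bm_ln_y dl : 0 < dl -> bounded_meas (fun p => ln (p.1.2 + dl)).
Proof.
by move=> d0; apply: (@bm_ln _ _ _ dl) => //; [bm|move=> p /Lambda_y_ge0 y0; rewrite lerDr].
Qed.

Lemma bm_ln_onem_y dl : 0 < dl -> bounded_meas (fun p => ln (1 - p.1.2 + dl)).
Proof.
move=> d0; apply: (@bm_ln _ _ _ dl) => //; first by bm.
by move=> p /Lambda_bounds[_ /andP[_ y1] _]; rewrite lerDr subr_ge0.
Qed.

Lemma lyapE : lyap c mu = mean (fun p => ln (central_deriv c p)).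
Proof.
apply: mean_eq => p Lp.
by rewrite DFcE // /central_deriv_iter big_ord1.
Qed.

Lemma lyap_le_shift dl : 0 < dl <= 1 ->
  lyap c mu + 1 / 3 * mean (fun p => in_slab1 p * (1 - p.1.2)) <=
  (expR (-1))^-1 * mean (fun p => dl / (p.1.2 + dl)).
Proof.
move=> /andP[d0 d1].
have bq : bounded_meas (fun p => dl / (p.1.2 + dl)).
  by apply: bm_shift_inv => //; [exact: bm_y|exact: Lambda_y_ge0].
have b1 := bm_ln_y d0; have b2 := bm_ln_onem_y d0.
have b3 : bounded_meas (fun p => in_slab1 p * (1 - p.1.2)) by bm.
have := @mean_coboundary _ _ _ muI (fun p => log_sum dl p.1.2)
  (fun p => ln (central_deriv c p) + 1 / 3 * (in_slab1 p * (1 - p.1.2)) -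
            (expR (-1))^-1 * (dl / (p.1.2 + dl))).
have -> : mean (fun p => ln (central_deriv c p) + 1 / 3 * (in_slab1 p * (1 - p.1.2)) -
            (expR (-1))^-1 * (dl / (p.1.2 + dl))) =
  lyap c mu + 1 / 3 * mean (fun p => in_slab1 p * (1 - p.1.2)) -
   (expR (-1))^-1 * mean (fun p => dl / (p.1.2 + dl)).
  by rewrite meanB ?meanD ?(meanZ muI (1 / 3) b3) ?(meanZ muI (expR (-1))^-1 bq) ?lyapE //; bm.
move=> H; rewrite -subr_le0; apply: H; [by rewrite /log_sum; bm|by bm|].
move=> p Lp; have [_ y01 _] := Lambda_bounds Lp.
rewrite F_y /central_deriv /in_slab1; case: ifP => _.
  by have := log_sum_fiber y01 d0; lra.
have := log_sum_contr y01 (introT andP (conj d0 d1)) (sigma_bounds c).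
have : 0 <= (expR (-1))^-1 * (dl / (p.1.2 + dl)).
  have y0 := Lambda_y_ge0 Lp.
  by rewrite mulr_ge0 ?invr_ge0 ?expR_ge0 ?divr_ge0 ?addr_ge0 ?(ltW d0).
by lra.
Qed.

(** The transfer function is - [log_diff]. On z <= 1/6 it drops by at most 1. On the other slab
    [log_diff] is nonpositive at the image, so the rise is at least [log_diff] at the point itself,
    which [log_diff_ge] bounds below. *)
Lemma mean_slab1_le dl : 0 < dl ->
  ln ((1 + dl) / dl) * mean in_slab1 <=
  1 + 2 / dl * mean (fun p => in_slab1 p * (1 - p.1.2)).
Proof.
move=> d0; have b1 := bm_ln_y d0; have b2 := bm_ln_onem_y d0.
have b3 : bounded_meas (fun p => in_slab1 p * (1 - p.1.2)) by bm.
have := @mean_coboundary _ _ _ muI (fun p => - log_diff dl p.1.2)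
  (fun p => ln ((1 + dl) / dl) * in_slab1 p - 1 -
    2 / dl * (in_slab1 p * (1 - p.1.2))).
have -> : mean (fun p => ln ((1 + dl) / dl) * in_slab1 p - 1 -
    2 / dl * (in_slab1 p * (1 - p.1.2))) =
   ln ((1 + dl) / dl) * mean in_slab1 - 1 - 2 / dl * mean (fun p => in_slab1 p * (1 - p.1.2)).
  by rewrite !meanB ?meanZ ?mean_cst //; bm.
move=> H; rewrite -subr_le0 opprD addrA; apply: H; [by rewrite /log_diff; bm|by bm|].
move=> p Lp; have [_ y01 _] := Lambda_bounds Lp.
rewrite F_y /in_slab1; case: ifP => _.
  by have := log_diff_fiber y01 d0; lra.
by have := log_diff_contr y01 d0 (sigma_bounds c); have := log_diff_ge y01 d0; lra.
Qed.

(** The first branch raises y by at least y (1 - y) / 2, and the second lowers it by a bounded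
    amount. The next two lemmas follow the same scheme with z, expanded by the first branch, and
    with - x, since x is contracted there. *)
Lemma mean_logistic_le : mean (fun p => p.1.2 * (1 - p.1.2)) <= 4 * mean in_slab1.
Proof.
have b1 : bounded_meas (fun p => p.1.2 * (1 - p.1.2)) by bm.
have := @mean_coboundary _ _ _ muI (fun p => p.1.2)
  (fun p => 1 / 2 * (p.1.2 * (1 - p.1.2)) - 2 * in_slab1 p).
rewrite meanB ?meanZ //; [|by bm..].
move=> H; suff : 1 / 2 * mean (fun p => p.1.2 * (1 - p.1.2)) - 2 * mean in_slab1 <= 0 by lra.
apply: H; [by bm|by bm|move=> p Lp]; have [_ y01 _] := Lambda_bounds Lp.
rewrite F_y /in_slab1; case: ifP => _; first by have := fiber_map_gain y01; lra.
have /andP[s0 _] := sigma_bounds c; case/andP: y01 => y0 y1.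
have : 0 <= sigma c * (1 - p.1.2) by rewrite mulr_ge0 ?(ltW s0) // subr_ge0.
by nra.
Qed.

Lemma mean_z_le : mean (fun p => p.2) <= 7 / 5 * mean in_slab1.
Proof.
have := @mean_coboundary _ _ _ muI (fun p => p.2) (fun p => 5 * p.2 - 7 * in_slab1 p).
rewrite meanB ?meanZ //; [|by bm..].
move=> H; suff : 5 * mean (fun p => p.2) - 7 * mean in_slab1 <= 0 by lra.
apply: H; [by bm|by bm|move=> p Lp]; have [_ _ z01] := Lambda_bounds Lp.
have z0 : 0 <= p.2 by lra.
have b0 := beta0_bounds c; have b1 := beta1_bounds c.
rewrite F_z /in_slab1; case: ifP => z6; first by nra.
by case/orP: z01 => z01; [lra|nra].
Qed.

Lemma mean_x_le : mean (fun p => p.1.1) <= 3 * mean in_slab1.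
Proof.
have := @mean_coboundary _ _ _ muI (fun p => - p.1.1) (fun p => 2 / 3 * p.1.1 - 2 * in_slab1 p).
rewrite meanB ?meanZ //; [|by bm..].
move=> H; suff : 2 / 3 * mean (fun p => p.1.1) - 2 * mean in_slab1 <= 0 by lra.
apply: H; [by bm|by bm|move=> p Lp]; have [/andP[x0 x1] _ _] := Lambda_bounds Lp.
have l0 := lam0_bounds c; have l1 := lam1_bounds c.
by rewrite F_x /in_slab1; case: ifP => z6; nra.
Qed.

(** Pointwise, ln |DF| is close to 1 - 2 y on z <= 1/6 by [ln_fiber_deriv_approx]; on the other slab
    a crude bound is charged to the measure of that slab. *)
Lemma lyap_approx : `|lyap c mu - (1 - 2 * mean (fun p => p.1.2))| <=
  4 * (expR (-1))^-1 * mean (fun p => p.1.2 * (1 - p.1.2)) +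
  (`|ln (sigma c)| + 1) * mean in_slab1.
Proof.
have b1 : bounded_meas (fun p => p.1.2 * (1 - p.1.2)) by bm.
pose w p := 4 * (expR (-1))^-1 * (p.1.2 * (1 - p.1.2)) + (`|ln (sigma c)| + 1) * in_slab1 p.
have bw : bounded_meas w by rewrite /w; bm.
have wE : mean w = 4 * (expR (-1))^-1 * mean (fun p => p.1.2 * (1 - p.1.2)) +
  (`|ln (sigma c)| + 1) * mean in_slab1.
  by rewrite /w meanD ?meanZ //; bm.
have lE : mean (fun p => ln (central_deriv c p) - (1 - 2 * p.1.2)) =
    lyap c mu - (1 - 2 * mean (fun p => p.1.2)).
  by rewrite !meanB ?meanZ ?mean_cst ?lyapE //; bm.
have H p : Lambda p -> `|ln (central_deriv c p) - (1 - 2 * p.1.2)| <= w p.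
  move=> Lp; have [_ y01 _] := Lambda_bounds Lp.
  rewrite /central_deriv /w /in_slab1; case: ifP => _.
    by rewrite mulr0 addr0; exact: ln_fiber_deriv_approx.
  rewrite mulr1 ler_wpDl //.
    case/andP: y01 => y0 y1.
    by rewrite !mulr_ge0 ?invr_ge0 ?expR_ge0 // subr_ge0.
  apply: (le_trans (ler_normB _ _)); rewrite lerD2l ler_norml; lra.
rewrite -wE -lE ler_norml -[X in - X]mul1r -mulNr -meanZ //; apply/andP; split.
  apply: mean_le => //; [by bm..|] => p /H; rewrite ler_norml; lra.
by apply: mean_le => //; [by bm..|] => p /H; rewrite ler_norml; lra.
Qed.

End Estimates.

(** * The mass of y = 0 and the sign of the exponent *)

Section NoMassAtQ.
Context {R : realType} (c : params R).
Local Notation R3 := (R * R * R)%type.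
Local Notation F := (F c).
Local Notation Lambda := (Lambda c).
Local Notation bounded_meas := (bounded_meas c).
Local Notation in_slab1 := (@in_slab1 R).
Implicit Types p : R3.

(** The quotient is 1 / (1 + N t), which is at least 1 - N t. If t has nonpositive mean, the
    correction N t disappears after integration, for every N. *)
Lemma one_le_shift_inv_add (t N : R) : 0 <= t -> 0 < N ->
  1 <= N^-1 / (t + N^-1) + N * t.
Proof.
move=> t0 N0; have s0 : 0 <= N * t by rewrite mulr_ge0 // ltW.
have -> : N^-1 / (t + N^-1) = (1 + N * t)^-1.
  have tN : t + N^-1 != 0 by rewrite gt_eqF // ltr_wpDl ?invr_gt0.
  have tN' : 1 + N * t != 0 by rewrite gt_eqF // ltr_wpDr.
  apply: (mulIf tN'); rewrite mulVf // mulrAC; apply: (mulIf tN).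
  by rewrite mulfVK // mul1r mulrDr mulr1 mulKf ?gt_eqF // addrC.
rewrite -lerBlDr -[leRHS]mul1r ler_pdivlMr ?ltr_wpDr //.
by nra.
Qed.

Definition zero_ind (q : R3 -> R) p : R := if q p == 0 then 1 else 0.

Lemma bm_zero_ind q : bounded_meas q -> bounded_meas (zero_ind q).
Proof.
move=> [mq _]; split.
  by apply: measurable_fun_ifT => //; exact: measurable_fun_eqr.
by exists 1 => p _; rewrite /zero_ind; case: ifP => _; rewrite ?normr0 ?normr1.
Qed.

Section Mean.
Variable mu : probability R3 R.
Hypothesis muI : invariant_measure c mu.
Local Notation mean := (mean c mu).
Let bS := bm_in_slab1 c.

(** For q >= 0 these functions are bounded by 1 and tend to the indicator of q = 0, so dominated
    convergence applies. *)
Lemma mean_shift_inv_cvg q : bounded_meas q -> (forall p, Lambda p -> 0 <= q p) ->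
  mean (fun p => n.+1%:R^-1 / (q p + n.+1%:R^-1)) @[n --> \oo] --> mean (zero_ind q).
Proof.
move=> bq q0.
have n0 n : (0 : R) < n.+1%:R^-1 by rewrite invr_gt0.
have bn n : bounded_meas (fun p => n.+1%:R^-1 / (q p + n.+1%:R^-1)) by exact: bm_shift_inv.
have bz := bm_zero_ind bq.
have mL := measurable_Lambda c.
have cv p : Lambda p ->
    (n.+1%:R^-1 / (q p + n.+1%:R^-1))%:E @[n --> \oo] --> (zero_ind q p)%:E.
  move=> Lp; apply: cvg_EFin; first exact: nearW.
  rewrite /zero_ind; case: eqP => [qp|/eqP qp].
    have -> : (fine \o (fun n => (n.+1%:R^-1 / (q p + n.+1%:R^-1))%:E)) = (fun=> 1).
      by apply/funext => n /=; rewrite qp add0r divff ?gt_eqF.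
    exact: cvg_cst.
  rewrite -(mul0r (q p + 0)^-1); apply: cvgM; first exact: cvg_harmonic.
  apply: cvgV; first by rewrite addr0.
  by apply: cvgD; [exact: cvg_cst|exact: cvg_harmonic].
have bd p n : Lambda p -> (`|(n.+1%:R^-1 / (q p + n.+1%:R^-1))%:E| <= 1)%E.
  move=> Lp; rewrite /= lee_fin ger0_norm ?divr_ge0 ?addr_ge0 ?q0 ?(ltW (n0 _)) //.
  by rewrite ler_pdivrMr ?mul1r ?lerDr ?q0 // ltr_wpDl ?q0.
have [_ _ dc] := @dominated_convergence _ _ _ mu Lambda mL
  (fun n p => (n.+1%:R^-1 / (q p + n.+1%:R^-1))%:E) (fun p => (zero_ind q p)%:E)
  (fun=> 1%E)
  (fun n => (measurable_EFinP _ _).2 (measurable_funTS (bn n).1))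
  ((measurable_EFinP _ _).2 (measurable_funTS bz.1))
  (aeW _ cv) (bounded_meas_integrable muI (bm_cst c 1)) (aeW _ bd).
apply: fine_cvg; rewrite fineK; first exact: dc.
exact: (integrable_fin_num mL (bounded_meas_integrable muI bz)).
Qed.

Local Notation at_y0 := (zero_ind (fun p => p.1.2)).
Local Notation at_y1 := (zero_ind (fun p => 1 - p.1.2)).
Local Notation at_Q := (zero_ind (fun p => p.1.1 + p.1.2 + p.2)).

Lemma fiber_map_eq0 (y : R) : 0 <= y <= 1 -> (fiber_map y == 0) = (y == 0).
Proof.
move=> y01; rewrite fiber_mapE mulf_eq0 invr_eq0.
by rewrite (gt_eqF (fiber_denom_gt0 y01)) orbF.
Qed.

Lemma onem_fiber_map_eq0 (y : R) : 0 <= y <= 1 -> (1 - fiber_map y == 0) = (1 - y == 0).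
Proof.
move=> y01; rewrite fiber_map_onem // !mulf_eq0 invr_eq0.
by rewrite (gt_eqF (fiber_denom_gt0 y01)) (gt_eqF (expR_gt0 _)) !orbF.
Qed.

Let b0 : bounded_meas at_y0. Proof. by apply: bm_zero_ind; bm. Qed.
Let b1 : bounded_meas at_y1. Proof. by apply: bm_zero_ind; bm. Qed.
Let bQ : bounded_meas at_Q. Proof. by apply: bm_zero_ind; bm. Qed.

(* The transfer function is the indicator of y = 0 or y = 1: a point with y = 0 in
   the slab z >= 5/6 is sent to y = sigma and never returns to y = 0 or y = 1. *)
Lemma mean_y0_slab1 : mean (fun p => at_y0 p * in_slab1 p) <= 0.
Proof.
apply: (@mean_coboundary _ _ _ muI (fun p => - (at_y0 p + at_y1 p))); [by bm|by bm|].
move=> p Lp; have [_ y01 _] := Lambda_bounds Lp.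
rewrite /zero_ind /= F_y /in_slab1; case: (leP p.2 (1 / 6)) => _.
  by rewrite fiber_map_eq0 // onem_fiber_map_eq0 // mulr0 subrr.
have /andP[s0 s1] := sigma_bounds c; case/andP: y01 => y0 y1.
rewrite mulf_eq0 (gt_eqF s0) /= mulr1.
have -> : (1 - sigma c * (1 - p.1.2) == 0) = false by apply/negbTE; rewrite gt_eqF //; nra.
by case: eqP => y_eq; case: eqP => y1_eq; lra.
Qed.

(** The first branch preserves y = 0 and there raises z by more than 5 z. Entering y = 0 from y = 1
    can only raise the transfer function, and leaving it happens only in z > 1/6, which
    [mean_y0_slab1] controls. *)
Lemma mean_y0_z : mean (fun p => at_y0 p * p.2) <= 0.
Proof.
suff : 5 * mean (fun p => at_y0 p * p.2) - 6 * mean (fun p => at_y0 p * in_slab1 p) <= 0.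
  by have := mean_y0_slab1; lra.
have bz : bounded_meas (fun p => at_y0 p * p.2) by bm.
have bs : bounded_meas (fun p => at_y0 p * in_slab1 p) by bm.
rewrite -(meanZ muI 5 bz) -(meanZ muI 6 bs) -meanB //; [|by bm..].
apply: (@mean_coboundary _ _ _ muI (fun p => at_y0 p * p.2)); [by bm|by bm|].
move=> p Lp; have [_ y01 z01] := Lambda_bounds Lp.
have z0 : 0 <= p.2 by lra.
have /andP[s0 s1] := sigma_bounds c; have B0 := beta0_bounds c; have B1 := beta1_bounds c.
rewrite /zero_ind /= F_y F_z /in_slab1; case: (leP p.2 (1 / 6)) => z6.
  by rewrite fiber_map_eq0 //; case: eqP => _; nra.
have z5 : 5 / 6 <= p.2 <= 1 by case/orP: z01 => // /andP[_]; rewrite leNgt z6.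
have ? : 0 <= beta1 c * (p.2 - 5 / 6) by rewrite mulr_ge0; lra.
rewrite mulf_eq0 (gt_eqF s0) /=.
by case: eqP => y_eq; case: eqP => y1_eq; lra.
Qed.

Lemma mean_y0_x : mean (fun p => at_y0 p * p.1.1) <= 0.
Proof.
suff : 2 / 3 * mean (fun p => at_y0 p * p.1.1) - mean (fun p => at_y0 p * in_slab1 p) <= 0.
  by have := mean_y0_slab1; lra.
have bx : bounded_meas (fun p => at_y0 p * p.1.1) by bm.
have bs : bounded_meas (fun p => at_y0 p * in_slab1 p) by bm.
rewrite -(meanZ muI (2 / 3) bx) -meanB //; [|by bm..].
(* Here 1 - x is used rather than - x: at a point of y = 1 sent into y = 0 the transfer function
   jumps from 0 to its new value, which has to be nonnegative. *)
apply: (@mean_coboundary _ _ _ muI (fun p => at_y0 p * (1 - p.1.1))); [by bm|by bm|].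
move=> p Lp; have [x01 y01 z01] := Lambda_bounds Lp.
have [x01' _ _] := Lambda_bounds (Lambda_F Lp).
have /andP[s0 s1] := sigma_bounds c; have L0 := lam0_bounds c; have L1 := lam1_bounds c.
move: x01'; rewrite /zero_ind /= F_y F_x /in_slab1; case: (leP p.2 (1 / 6)) => z6 x01'.
  by rewrite fiber_map_eq0 //; case: eqP => _; nra.
rewrite mulf_eq0 (gt_eqF s0) /=.
by case: eqP => y_eq; case: eqP => y1_eq; lra.
Qed.

(* On y = 0 the previous bounds say that x + z vanishes in mean. *)
Lemma mean_y0_le_Q : mean at_y0 <= mean at_Q.
Proof.
have bx : bounded_meas (fun p => at_y0 p * p.1.1) by bm.
have bz : bounded_meas (fun p => at_y0 p * p.2) by bm.
have bq : bounded_meas (fun p => p.1.1 + p.1.2 + p.2) by bm.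
have q0 p : Lambda p -> 0 <= p.1.1 + p.1.2 + p.2 by case/Lambda_bounds; lra.
have n0 n : (0 : R) < n.+1%:R^-1 by rewrite invr_gt0.
have bn n := bm_shift_inv bq q0 (n0 n).
have le n : mean at_y0 <= mean (fun p => n.+1%:R^-1 / (p.1.1 + p.1.2 + p.2 + n.+1%:R^-1)).
  apply: (@le_trans _ _ (mean (fun p => n.+1%:R^-1 / (p.1.1 + p.1.2 + p.2 + n.+1%:R^-1)) +
      n.+1%:R * (mean (fun p => at_y0 p * p.1.1) + mean (fun p => at_y0 p * p.2)))).
    have bnn := bn n.
    rewrite -meanD // -meanZ //; last by bm.
    rewrite -meanD //; last by bm.
    apply: mean_le => //; first by bm.
    move=> p Lp; have [x01 y01 z01] := Lambda_bounds Lp.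
    rewrite /zero_ind; case: eqP => [->|_]; last first.
      rewrite !mul0r addr0 mulr0 addr0.
      exact: divr_ge0 (ltW (n0 n)) (addr_ge0 (q0 p Lp) (ltW (n0 n))).
    rewrite !mul1r addr0; set t := p.1.1 + p.2.
    have t0 : 0 <= t by rewrite /t; lra.
    exact: one_le_shift_inv_add.
  rewrite gerDl pmulr_rle0 ?ltr0n //.
  by have := mean_y0_x; have := mean_y0_z; lra.
apply: (cvgr_to_ge (mean_shift_inv_cvg bq q0)).
by near=> n; exact: le.
Unshelve. all: by end_near. Qed.

Lemma measurable_set1_R3 (p : R3) : measurable [set p].
Proof.
by apply: closed_measurable_R3; apply: compact_closed; [exact: norm_hausdorff|exact: compact_set1].
Qed.

Lemma at_QE p : Lambda p -> at_Q p = \1_[set Q] p.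
Proof.
move=> /Lambda_bounds[x01 y01 z01]; rewrite indicE /zero_ind.
case: eqP => [q0|q0].
  rewrite mem_set //; apply: R3_ext => /=; lra.
rewrite memNset // => pQ; apply: q0.
by rewrite pQ /Q /= !addr0.
Qed.

Lemma mean_at_Q : mean at_Q = fine (mu [set Q]).
Proof.
rewrite (mean_eq mu at_QE) /mean /Rintegral integral_indic.
- by congr (fine (mu _)); apply/setIidPl => _ ->; exact: Lambda_Q.
- exact: measurable_Lambda.
- exact: measurable_set1_R3.
Qed.

Lemma lyap_of_dirac_Q : mu [set Q] = 1%E -> lyap c mu = 1.
Proof.
move=> muQ; have := mean_at_Q; rewrite muQ /= => mQ.
have bL := bm_ln_central_deriv c; have [_ [M LM]] := bL.
have M0 : 0 <= M by apply: le_trans (LM _ (Lambda_Q c)).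
(* Zero at Q, where ln |DF| = 1, and at least the distance of ln |DF| to 1 elsewhere; its mean is 0
   because Q has full mass. *)
pose w p := (M + 1) * (1 - at_Q p).
have bw : bounded_meas w by rewrite /w; bm.
have wE : mean w = 0.
  by rewrite /w meanZ ?meanB ?mean_cst ?mQ ?subrr ?mulr0 //; bm.
have H p : Lambda p -> `|ln (central_deriv c p) - 1| <= w p.
  move=> Lp; rewrite /w at_QE // indicE; have [pQ|pQ] := pselect (p = Q).
    rewrite mem_set // subrr mulr0 pQ /central_deriv /= divr_ge0 //=.
    rewrite ln_fiber_deriv ?lexx ?ler01 // /fiber_denom subr0 mul1r add0r expRK.
    by rewrite mulrN1 opprK [_ - 1]addrC addrA normr_le0; apply/eqP; ring.
  rewrite memNset // subr0 mulr1; apply: (le_trans (ler_normB _ _)).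
  by rewrite normr1 lerD2r LM.
have lE : mean (fun p => ln (central_deriv c p) - 1) = lyap c mu - 1.
  by rewrite meanB ?mean_cst ?lyapE //; bm.
have U : mean (fun p => ln (central_deriv c p) - 1) <= mean w.
  by apply: mean_le => //; [by bm|] => p /H; rewrite ler_norml; lra.
have L : mean (fun p => -1 * w p) <= mean (fun p => ln (central_deriv c p) - 1).
  by apply: mean_le => //; [by bm|by bm|] => p /H; rewrite ler_norml; lra.
by move: U L; rewrite (meanZ muI (-1) bw) wE lE; lra.
Qed.

Lemma mean_slab1_ge0 : 0 <= mean in_slab1.
Proof. by apply: mean_ge0 => p _; rewrite /in_slab1; case: ifP. Qed.

Section NoAtom.
Hypothesis muQ : mu [set Q] = 0%E.

Lemma mean_y0_le0 : mean at_y0 <= 0.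
Proof. by apply: (le_trans mean_y0_le_Q); rewrite mean_at_Q muQ. Qed.

Let bq : bounded_meas (fun p => p.1.2). Proof. exact: bm_y. Qed.
Let q0 p : Lambda p -> 0 <= p.1.2. Proof. exact: Lambda_y_ge0. Qed.

(** Limit of [lyap_le_shift] as [dl] tends to 0: the mean of the error tends to the mass of y = 0,
    which vanishes when Q is not an atom. *)
Lemma lyap_le_slab1 : lyap c mu + 1 / 3 * mean (fun p => in_slab1 p * (1 - p.1.2)) <= 0.
Proof.
have e0 : 0 <= (expR (-1 : R))^-1 by rewrite invr_ge0 expR_ge0.
apply: (@le_trans _ _ ((expR (-1))^-1 * mean at_y0)); last first.
  by rewrite mulr_ge0_le0 // mean_y0_le0.
have cv : (expR (-1))^-1 * mean (fun p => n.+1%:R^-1 / (p.1.2 + n.+1%:R^-1)) @[n --> \oo]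
    --> (expR (-1))^-1 * mean at_y0.
  by apply: cvgM; [exact: cvg_cst|exact: mean_shift_inv_cvg].
apply: (cvgr_to_ge cv); near=> n; apply: (lyap_le_shift muI).
by rewrite invr_gt0 ltr0n /= invf_le1 ?ltr0n // ler1n.
Unshelve. all: by end_near. Qed.

Lemma mean_slab1_y_ge0 : 0 <= mean (fun p => in_slab1 p * (1 - p.1.2)).
Proof.
apply: mean_ge0 => p /Lambda_bounds[_ /andP[_ y1] _]; rewrite /in_slab1.
by case: ifP => _; rewrite ?mul0r ?mul1r ?subr_ge0.
Qed.

Lemma lyap_le0 : lyap c mu <= 0.
Proof. by have := lyap_le_slab1; have := mean_slab1_y_ge0; lra. Qed.

(* [mean_slab1_le] with d = exp (- K). *)
Lemma mean_slab1_le_lyap (K : R) : 0 < K ->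
  K * mean in_slab1 <= 1 + 6 * expR K * - lyap c mu.
Proof.
move=> K0; have d0 := expR_gt0 (- K).
have H1 := mean_slab1_le muI d0.
have KA : K <= ln ((1 + expR (- K)) / expR (- K)).
  rewrite -[leLHS]expRK ler_ln_pos ?expR_gt0 //.
  by rewrite expRN invrK mulrDl mul1r lerDl mulr_ge0 ?invr_ge0 ?expR_ge0.
have S0 := mean_slab1_ge0.
have : K * mean in_slab1 <= ln ((1 + expR (- K)) / expR (- K)) * mean in_slab1.
  exact: ler_wpM2r.
rewrite {3}expRN invrK in H1.
have e0 := expR_gt0 K.
have : expR K * mean (fun p => in_slab1 p * (1 - p.1.2)) <= expR K * (3 * - lyap c mu).
  by rewrite ler_pM2l //; have := lyap_le_slab1; lra.
lra.
Qed.

(** A zero exponent would make the slab z >= 5/6 null, then y (1 - y) of mean 0 and y of mean 1/2.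
    Half of the mass would lie on y = 0, against [mean_y0_le0]. *)
Lemma lyap_lt0 : lyap c mu < 0.
Proof.
rewrite lt_neqAle lyap_le0 andbT; apply/eqP => l0.
have S0 : mean in_slab1 <= 0.
  rewrite leNgt; apply/negP => S0.
  (* With this K the inequality reads 2 <= 1. *)
  have := @mean_slab1_le_lyap (2 / mean in_slab1) ltac:(by rewrite divr_gt0).
  by rewrite l0 oppr0 mulr0 addr0 divfK ?gt_eqF //; lra.
have {}S0 : mean in_slab1 = 0 by apply/eqP; rewrite eq_le S0 mean_slab1_ge0.
have := lyap_approx muI; have := mean_logistic_le muI; rewrite S0 l0 !mulr0 addr0.
set l := mean _ => l1.
have l2 : 0 <= l.
  by apply: mean_ge0 => p /Lambda_bounds[_ /andP[? ?] _]; rewrite mulr_ge0 // subr_ge0.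
have l3 : l = 0 by lra.
rewrite l3 mulr0 normr_le0 => /eqP y2.
have by1 : bounded_meas (fun p => p.1.2 * (1 - p.1.2)) by bm.
have le n : 1 / 2 <= mean (fun p => n.+1%:R^-1 / (p.1.2 + n.+1%:R^-1)).
  have n0 : (0 : R) < n.+1%:R^-1 by rewrite invr_gt0.
  have bn := bm_shift_inv bq q0 n0.
  apply: (@le_trans _ _ (mean (fun p => n.+1%:R^-1 / (p.1.2 + n.+1%:R^-1)) + n.+1%:R * l)); last first.
    by rewrite l3 mulr0 addr0.
  rewrite /l -meanZ // -meanD //; last by bm.
  apply: (@le_trans _ _ (mean (fun p => 1 - p.1.2))).
    by rewrite meanB ?mean_cst //; [lra|bm].
  apply: mean_le => //; [by bm|by bm|].
  move=> p /Lambda_bounds[_ /andP[y0 y1] _].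
  have N0 : (0 : R) < n.+1%:R by rewrite ltr0n.
  (* Multiplied by 1 - y, this gives 1 - y <= A + N y (1 - y), whose last term has mean 0. *)
  have := one_le_shift_inv_add y0 N0.
  have : 0 <= n.+1%:R^-1 / (p.1.2 + n.+1%:R^-1) by rewrite divr_ge0 ?addr_ge0 ?(ltW n0).
  set A := _ / _; set N := n.+1%:R; nra.
suff : 1 / 2 <= mean at_y0 by have := mean_y0_le0; lra.
apply: (cvgr_to_ge (mean_shift_inv_cvg bq q0)).
by near=> n; exact: le.
Unshelve. all: by end_near. Qed.

End NoAtom.

End Mean.

Section Ergodic.
Variable mu : probability R3 R.
Hypothesis muE : ergodic_measure c mu.

(** The second branch has x >= 3/4 - 1/3 > 0 and the first fixes only Q over Q. Thus the singleton
    of Q is an invariant set, to which ergodicity applies. *)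
Lemma F_preimage_Q : Lambda `&` F @^-1` [set Q] = [set Q].
Proof.
apply/seteqP; split=> [p [Lp /= pQ]|_ ->]; last first.
  by split; [exact: Lambda_Q|exact: F_Q].
have [/andP[x0 x1] y01 z01] := Lambda_bounds Lp.
have := F_x c p; have := F_y c p; have := F_z c p; rewrite pQ /=.
have L0 := lam0_bounds c; have L1 := lam1_bounds c; have B0 := beta0_bounds c.
case: ifP => z6 zE yE xE; last by exfalso; clear pQ zE yE; nra.
apply: R3_ext => /=.
- by apply/eqP; move/esym/eqP: xE; rewrite mulf_eq0 => /orP[/eqP|//]; lra.
- by apply/eqP; rewrite -fiber_map_eq0 // -yE.
- by apply/eqP; move/esym/eqP: zE; rewrite mulf_eq0 => /orP[/eqP|//]; lra.
Qed.

Lemma ergodic_Q01 : mu [set Q] = 0%E \/ mu [set Q] = 1%E.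
Proof.
apply: muE.2; [exact: measurable_set1_R3|by move=> _ ->; exact: Lambda_Q|exact: F_preimage_Q].
Qed.

Lemma dirac_Q_of_atom : mu [set Q] = 1%E ->
  forall A : set R3, measurable A -> mu A = \d_Q A.
Proof.
move=> muQ A mA; have mQ := measurable_set1_R3 (Q : R3).
rewrite diracE; have [QA|QA] := pselect (A Q).
  rewrite mem_set //; apply/eqP; rewrite eq_le probability_le1 //= -muQ.
  by apply: le_measure; rewrite ?inE // => _ ->.
have QC0 : mu (~` [set Q]) = 0%E by rewrite probability_setC // muQ subee.
rewrite memNset //; apply: (@subset_measure0 _ _ _ _ _ (~` [set Q])) => //.
- exact: measurableC.
- by move=> p Ap pQ; apply: QA; rewrite -pQ.
Qed.

End Ergodic.
End NoMassAtQ.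

(** * Weak-star limits *)

Section WeakStar.
Context {R : realType} (c : params R).
Local Notation R3 := (R * R * R)%type.
Local Notation Lambda := (Lambda c).
Local Notation bounded_meas := (bounded_meas c).
Local Notation in_slab1 := (@in_slab1 R).
Implicit Types (p : R3) (g : R3 -> R).

Lemma within_continuous_bounded g : {within Lambda, continuous g} ->
  exists2 B, 0 <= B & forall p, Lambda p -> `|g p| <= B.
Proof.
move=> cg; have /compact_bounded[M [_ HM]] := continuous_compact cg (@compact_Lambda R c).
exists (`|M| + 1); first by rewrite addr_ge0.
by move=> p Lp; apply: (HM (`|M| + 1)); [rewrite (le_lt_trans (ler_norm M)) // ltrDl|exists p].
Qed.

Lemma bm_within_continuous g : {within Lambda, continuous g} -> bounded_meas (g \_ Lambda).
Proof.
move=> cg; have [B _ gB] := within_continuous_bounded cg; split.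
  apply/(measurable_restrictT _ _).1; first exact: measurable_Lambda.
  exact: (within_continuous_measurable_R3 (@closed_Lambda _ c) cg).
by exists B => p Lp; rewrite patchE mem_set // gB.
Qed.

Lemma within_continuous_near g p0 (e : R) : {within Lambda, continuous g} ->
  Lambda p0 -> 0 < e -> exists2 r, 0 < r &
    forall p, Lambda p -> `|p0.1.1 - p.1.1| < r -> `|p0.1.2 - p.1.2| < r ->
      `|p0.2 - p.2| < r -> `|g p0 - g p| <= e.
Proof.
move=> /subspace_continuousP cg Lp0 e0.
have /cvgrPdist_le/(_ _ e0) := cg _ Lp0.
rewrite near_withinE => /nbhs_ballP[r /= r0 Hr].
by exists r => // p Lp hx hy hz; apply: Hr.
Qed.

Lemma half_QP_integral g : bounded_meas g ->
  \int[half_QP]_(p in Lambda) g p = (g Q + g P) / 2.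
Proof.
move=> [mg _].
have mL := measurable_Lambda c.
have LQ := Lambda_Q c; have LP := Lambda_P c.
have ge0 (h : R3 -> \bar R) : measurable_fun Lambda h -> (forall p, Lambda p -> (0 <= h p)%E) ->
    (\int[half_QP]_(p in Lambda) h p = 2^-1%:E * (h Q + h P))%E.
  move=> mh h0; rewrite /half_QP ge0_integral_mscale // ge0_integral_measure_add //.
  by rewrite !integral_dirac // !diracE !mem_set // !mul1e.
have mge : measurable_fun Lambda (EFin \o g) by apply/measurable_EFinP; exact: measurable_funTS.
rewrite /Rintegral integralE !ge0 //; try by move=> *; rewrite ?funepos_ge0 ?funeneg_ge0.
- rewrite !funeposE !funenegE /= -!EFin_max -!EFinD /=.
  have mx (a : R) : Num.max a 0 - Num.max (- a) 0 = a.
    by case: (leP a 0) => a0; case: (leP (- a) 0) => a1; lra.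
  by rewrite -[in RHS](mx (g Q)) -[in RHS](mx (g P)); lra.
- exact: measurable_funeneg.
- exact: measurable_funepos.
Qed.

(** The quantity multiplied by C vanishes on [Lambda] only at Q and P. Where it is small, p is near
    one of them and continuity of g applies; elsewhere a multiple of it dominates the bounded left
    side. *)
Lemma approx_by_endpoints g (e : R) : {within Lambda, continuous g} -> 0 < e ->
  exists2 C, 0 <= C & forall p, Lambda p ->
    `|g p - ((1 - p.1.2) * g Q + p.1.2 * g P)| <=
    e + C * (p.1.1 + p.2 + p.1.2 * (1 - p.1.2)).
Proof.
move=> cg e0; have [B B0 gB] := within_continuous_bounded cg.
have LQ := Lambda_Q c; have LP := Lambda_P c.
have [rQ rQ0 HQ] := within_continuous_near cg LQ e0.
have [rP rP0 HP] := within_continuous_near cg LP e0.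
pose k := Num.min rQ rP / 2.
have m0 : 0 < Num.min rQ rP by rewrite lt_min rQ0.
have k0 : 0 < k by rewrite divr_gt0.
have kQ : 2 * k <= rQ by rewrite /k mulrC divfK // ge_min lexx.
have kP : 2 * k <= rP by rewrite /k mulrC divfK // ge_min lexx orbT.
have gQ := gB _ LQ; have gP := gB _ LP.
have gQP : `|g Q - g P| <= 2 * B by apply: (le_trans (ler_normB _ _)); lra.
(* The term 2 B / k covers t >= k. The term 4 B covers the interpolation error near an endpoint: the
   distance of y to it is at most 2 t, times |g Q - g P| <= 2 B. *)
exists (4 * B + 2 * B / k); first by rewrite addr_ge0 ?divr_ge0 ?mulr_ge0 // ltW.
move=> p Lp; have [/andP[x0 x1] /andP[y0 y1] z01] := Lambda_bounds Lp.
have z0 : 0 <= p.2 by lra.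
have l0 : 0 <= p.1.2 * (1 - p.1.2) by rewrite mulr_ge0 // subr_ge0.
set t := p.1.1 + p.2 + p.1.2 * (1 - p.1.2).
have t0 : 0 <= t by rewrite /t; lra.
have tk0 : 0 <= 2 * B / k * t by rewrite mulr_ge0 ?divr_ge0 ?mulr_ge0 // ltW.
have gp := gB _ Lp.
rewrite [(_ + _) * t]mulrDl.
have [tk|kt] := ltP t k; last first.
  have H : 2 * B <= 2 * B / k * t.
    by rewrite mulrAC ler_pdivlMr // ler_wpM2l // mulr_ge0.
  have : `|g p - ((1 - p.1.2) * g Q + p.1.2 * g P)| <= 2 * B.
    apply: (le_trans (ler_normB _ _)).
    have : `|(1 - p.1.2) * g Q + p.1.2 * g P| <= B; last by lra.
    apply: (le_trans (ler_normD _ _)); rewrite !normrM (ger0_norm y0) ger0_norm ?subr_ge0 //.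
    by nra.
  have : 0 <= 4 * B * t by rewrite !mulr_ge0.
  by lra.
have xt : p.1.1 <= t by rewrite /t; lra.
have zt : p.2 <= t by rewrite /t; lra.
have yt : p.1.2 * (1 - p.1.2) <= t by rewrite /t; lra.
have [y2|y2] := leP p.1.2 (1 / 2).
  have yk : p.1.2 <= 2 * t by nra.
  have Hp : `|g Q - g p| <= e.
    by apply: HQ => //=; rewrite sub0r normrN ger0_norm //; clear -xt zt yk tk kQ t0; lra.
  have -> : g p - ((1 - p.1.2) * g Q + p.1.2 * g P) = - (g Q - g p) + p.1.2 * (g Q - g P) by ring.
  apply: (le_trans (ler_normD _ _)); rewrite normrN normrM (ger0_norm y0).
  have : p.1.2 * `|g Q - g P| <= 2 * t * (2 * B) by apply: ler_pM.
  by lra.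
have yk : 1 - p.1.2 <= 2 * t by nra.
have y1' : 0 <= 1 - p.1.2 by rewrite subr_ge0.
have Hp : `|g P - g p| <= e.
  by apply: HP => //=; rewrite ?sub0r ?normrN ger0_norm //; clear -xt zt yk tk kP t0 y1'; lra.
have -> : g p - ((1 - p.1.2) * g Q + p.1.2 * g P) = - (g P - g p) - (1 - p.1.2) * (g Q - g P) by ring.
apply: (le_trans (ler_normB _ _)); rewrite normrN normrM (ger0_norm y1').
have : (1 - p.1.2) * `|g Q - g P| <= 2 * t * (2 * B) by apply: ler_pM.
by lra.
Qed.

Section OneMeasure.
Variable mu : probability R3 R.
Hypothesis muI : invariant_measure c mu.
Local Notation mean := (mean c mu).
Let bS := bm_in_slab1 c.

Lemma mean_approx g (e C : R) : {within Lambda, continuous g} -> 0 <= C ->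
  (forall p, Lambda p -> `|g p - ((1 - p.1.2) * g Q + p.1.2 * g P)| <=
    e + C * (p.1.1 + p.2 + p.1.2 * (1 - p.1.2))) ->
  `|mean g - ((1 - mean (fun p => p.1.2)) * g Q + mean (fun p => p.1.2) * g P)| <=
  e + C * (9 * mean in_slab1).
Proof.
move=> cg C0 H; pose h := g \_ Lambda.
have bh : bounded_meas h by exact: bm_within_continuous.
have hg p : Lambda p -> g p = h p by move=> Lp; rewrite /h patchE mem_set.
rewrite (mean_eq mu hg).
pose w p := e + C * (p.1.1 + p.2 + p.1.2 * (1 - p.1.2)).
have bw : bounded_meas w by rewrite /w; bm.
have bt : bounded_meas (fun p => p.1.1 + p.2 + p.1.2 * (1 - p.1.2)) by bm.
have bl : bounded_meas (fun p => p.1.2 * (1 - p.1.2)) by bm.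
have S0 : 0 <= mean in_slab1 by exact: mean_slab1_ge0.
have wle : mean w <= e + C * (9 * mean in_slab1).
  rewrite /w meanD ?mean_cst ?(meanZ muI C bt) //; [|by bm..].
  rewrite lerD2l ler_wpM2l // !meanD //; [|by bm..].
  (* The constant 9 rounds up 3 + 7/5 + 4. *)
  have := mean_x_le muI; have := mean_z_le muI; have := mean_logistic_le muI; lra.
pose v p := h p - (g Q + (g P - g Q) * p.1.2).
have bv : bounded_meas v by rewrite /v; bm.
have by_ : bounded_meas (fun p => p.1.2) by bm.
have vE : mean v = mean h - ((1 - mean (fun p => p.1.2)) * g Q + mean (fun p => p.1.2) * g P).
  rewrite /v meanB ?meanD ?(meanZ muI (g P - g Q) by_) ?mean_cst //; [|by bm..].
  by ring.
have vw p : Lambda p -> `|v p| <= w p.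
  move=> Lp; have := H _ Lp; rewrite /v -hg //.
  by rewrite (_ : (1 - _) * _ + _ = g Q + (g P - g Q) * p.1.2) //; ring.
rewrite -vE; apply: le_trans wle; rewrite ler_norml; apply/andP; split.
  rewrite lerNl -mulN1r -(meanZ muI (-1) bv); apply: mean_le => //; first by bm.
  by move=> p /vw; rewrite ler_norml; lra.
by apply: mean_le => // p /vw; rewrite ler_norml; lra.
Qed.

Lemma mean_y_approx : `|mean (fun p => p.1.2) - 1 / 2| <=
  `|lyap c mu| + (16 * (expR (-1))^-1 + `|ln (sigma c)| + 1) * mean in_slab1.
Proof.
have e0 : 0 <= (expR (-1 : R))^-1 by rewrite invr_ge0 expR_ge0.
have H : 4 * (expR (-1))^-1 * mean (fun p => p.1.2 * (1 - p.1.2)) <=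
    16 * (expR (-1))^-1 * mean in_slab1.
  rewrite [leRHS](_ : _ = 4 * (expR (-1))^-1 * (4 * mean in_slab1)); last by ring.
  by apply: ler_wpM2l; [rewrite mulr_ge0|exact: mean_logistic_le].
have := lyap_approx muI; have := ler_norm (lyap c mu); have := ler_norm (- lyap c mu).
by rewrite normrN !ler_norml => ? ? ?; apply/andP; split; lra.
Qed.

End OneMeasure.

Lemma weak_star_half_QP (mu_ : nat -> probability R3 R) :
  (forall n, ergodic_measure c (mu_ n)) -> lyap c (mu_ n) @[n --> \oo] --> 0 ->
  weak_star_cvg c mu_ half_QP.
Proof.
move=> muE lyap0 g cg.
have muI n : invariant_measure c (mu_ n) := (muE n).1.
pose s n := mean c (mu_ n) in_slab1.
have s0 n : 0 <= s n by exact: mean_slab1_ge0.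
(* An atom at Q would have full mass and force the exponent to be 1, which is excluded once its
   modulus is below 1. *)
have noatom : \forall n \near \oo, mu_ n [set Q] = 0%E.
  have /cvgrPdist_lt/(_ 1 ltr01) := lyap0; apply: filterS => n l1.
  have [//|/(lyap_of_dirac_Q (muI n)) l] := ergodic_Q01 (muE n).
  by move: l1; rewrite l sub0r normrN normr1 ltxx.
have s_cvg : s n @[n --> \oo] --> (0 : R).
  (* K is fixed first, then n is taken so large that 6 exp K |lyap| <= 1; this gives K s n <= 2,
     that is s n <= e. *)
  apply/cvgrPdist_le => e e0; pose K := 2 / e.
  have K0 : 0 < K by rewrite divr_gt0.
  have d0 : 0 < (6 * expR K)^-1 by rewrite invr_gt0 mulr_gt0 ?expR_gt0.
  have /cvgrPdist_le/(_ _ d0) := lyap0; apply: filterS2 noatom => n Q0 ln.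
  rewrite sub0r normrN ger0_norm //.
  have := mean_slab1_le_lyap (muI n) Q0 K0; rewrite -/(s n).
  have : 6 * expR K * - lyap c (mu_ n) <= 1.
    rewrite mulrC -ler_pdivlMr ?mulr_gt0 ?expR_gt0 // mul1r.
    by apply: le_trans ln; rewrite sub0r ler_norm.
  move=> H1 H2; have : K * s n <= 2 by lra.
  by rewrite /K mulrAC ler_pdivrMr // ler_pM2l.
have hg : \int[half_QP]_(p in Lambda) g p = (g Q + g P) / 2.
  rewrite -[g Q](_ : (g \_ Lambda) Q = _); last by rewrite patchE mem_set //; exact: Lambda_Q.
  rewrite -[g P](_ : (g \_ Lambda) P = _); last by rewrite patchE mem_set //; exact: Lambda_P.
  rewrite -half_QP_integral; last exact: bm_within_continuous.
  by apply: eq_Rintegral => p pL; rewrite patchE pL.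
rewrite hg; apply/cvgrPdist_le => e e0.
have e20 : 0 < e / 2 by rewrite divr_gt0.
have [C C0 HC] := approx_by_endpoints cg e20.
pose D := 16 * (expR (-1))^-1 + `|ln (sigma c)| + 1.
(* The first term is the error of [mean_approx]; the second is the distance of the mean of y to 1/2,
   times the slope g P - g Q of the interpolation. *)
pose err n := C * (9 * s n) + `|g P - g Q| * (`|lyap c (mu_ n)| + D * s n).
have err0 : err n @[n --> \oo] --> (0 : R).
  rewrite (_ : 0 = C * (9 * 0) + `|g P - g Q| * (`|0 : R| + D * 0)); last first.
    by rewrite normr0; ring.
  apply: cvgD; apply: cvgM; [exact: cvg_cst| |exact: cvg_cst|apply: cvgD].
  - by apply: cvgM; [exact: cvg_cst|].
  - exact: cvg_norm.
  - by apply: cvgM; [exact: cvg_cst|].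
have /cvgrPdist_le/(_ _ e20) := err0; apply: filterS => n.
rewrite sub0r normrN => /(le_trans (ler_norm _)) errn.
have H1 := mean_approx (muI n) cg C0 HC.
have H2 := mean_y_approx (muI n).
set m := mean c (mu_ n) (fun p => p.1.2) in H1 H2.
rewrite -/(mean c (mu_ n) g) -/(s n) in H1 H2 *.
have -> : (g Q + g P) / 2 - mean c (mu_ n) g =
  - (mean c (mu_ n) g - ((1 - m) * g Q + m * g P)) - (m - 1 / 2) * (g P - g Q) by field.
apply: (le_trans (ler_normB _ _)); rewrite normrN normrM.
have : `|m - 1 / 2| * `|g P - g Q| <= `|g P - g Q| * (`|lyap c (mu_ n)| + D * s n).
  by rewrite mulrC ler_wpM2l.
rewrite /err in errn; lra.
Qed.

End WeakStar.

Theorem theorem2p1 (R : realType) (c : params R) :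
  ((forall p : R * R * R, Lambda c p -> recurrent c p -> p <> Q ->
      (limn_einf (fun n : nat => (n%:R^-1 * ln (DFc c n p))%:E) <= 0)%E) /\
   (forall mu : probability (R * R * R)%type R, ergodic_measure c mu ->
      ~ (forall A : set (R * R * R)%type, measurable A -> mu A = \d_Q A) ->
      lyap c mu < 0)) /\
  (forall mu_ : nat -> probability (R * R * R)%type R,
      (forall n, ergodic_measure c (mu_ n)) ->
      lyap c (mu_ n) @[n --> \oo] --> 0 ->
      weak_star_cvg c mu_ half_QP).
Proof.
split; last exact: weak_star_half_QP.
split; first exact: liminf_central_exponent.
move=> mu muE mu_neq.
have [muQ|/dirac_Q_of_atom/mu_neq[]] := ergodic_Q01 muE.
exact: lyap_lt0 muE.1 muQ.
Qed.
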